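(* Let $m>1$, let $P\subset\mathbb E^{2m}$ be a neighbourly $2m$-polytope with at least $2m+3$ vertices, let $\mathcal T=\{\Phi_1,\ldots,\Phi_m\}$ be a universal tower in $P$ given by the vertices $x_1,y_1,\ldots,x_m,y_m$, with $\Phi_0=\emptyset$, and let $P^+=[P,\bar x]$ be obtained by sewing $\bar x$ onto $P$ through $\mathcal T$. Let $0\le i<k<m$ and let $U\in\mathcal U_{2k-1}(P)$ with $\Phi_i\subseteq U$ and $x_{i+1}\notin U$. Then $U\in\mathcal U_{2k-1}(P^+)$ if and only if $i$ is even and $[U,\bar x,x_{i+1}]\in\mathcal U_{2k+1}(P^+)$.
   Context: $[A]$ denotes the convex hull; inside brackets, polytopes and points may be listed together. $\mathcal V(Q)$ is the vertex set of a polytope $Q$. A $d$-polytope is neighbourly if every $\lfloor d/2\rfloor$ of its vertices determine (are the vertex set of) a proper face. Even-dimensional neighbourly polytopes are simplicial. For a face $G$ of $Q$, the quotient $Q/G$ is a polytope (defined up to combinatorial equivalence) of dimension $\dim Q-\dim G-1$ whose face lattice is isomorphic to the interval $[G,Q]$ of the face lattice of $Q$. Universal faces: a $k$-face $U$ of a neighbourly polytope $Q$ is universal if either $U$ is a facet of $Q$, or $Q/U$ is a neighbourly polytope with exactly $|\mathcal V(Q)|-k-1$ vertices. $\mathcal U_k(Q)$ is the set of universal $k$-faces of $Q$. Universal towers: let $x_1,\ldots,x_m,y_1,\ldots,y_m$ be distinct vertices of the neighbourly $2m$-polytope $P$. Put $\Phi_0=\emptyset$ and $\Phi_j=[\Phi_{j-1},x_j,y_j]$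 for $1\le j\le m$. Then $\mathcal T=\{\Phi_1,\ldots,\Phi_m\}$ is a universal tower in $P$ if $\Phi_j\in\mathcal U_{2j-1}(P)$ for all $j=1,\ldots,m$. Sewing: let $\mathscr F_0$ be the set of all facets of $P$, $\mathscr F_j$ the set of facets of $P$ containing $\Phi_j$ for $1\le j\le m$, and $\mathscr F_j=\emptyset$ for $j>m$. Put $\mathcal C(\mathcal T)=(\mathscr F_1\setminus\mathscr F_2)\cup(\mathscr F_3\setminus\mathscr F_4)\cup\cdots$. A point $x\notin\operatorname{aff}F$ is beyond a facet $F$ of $P$ if $\operatorname{aff}F$ separates $x$ from $P$, and beneath $F$ otherwise. A point $\bar x$ lies exactly beyond $\mathcal C(\mathcal T)$ if it is beyond every $F\in\mathcal C(\mathcal T)$ and beneath every $F\in\mathscr F_0\setminus\mathcal C(\mathcal T)$; such a point exists for every universal tower (Shemer). For such $\bar x$, $P^+=[P,\bar x]$ is said to be obtained by sewing $\bar x$ onto $P$ through $\mathcal T$; it is a neighbourly $2m$-polytope with $\mathcal V(P^+)=\mathcal V(P)\cup\{\bar x\}$. *)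

(* Defs.v *)
From HB Require Import structures.
From mathcomp Require Import all_boot all_order all_algebra finmap.
From mathcomp Require Import boolp classical_sets functions cardinality.
From mathcomp Require Import reals convex.

Set Implicit Arguments.
Unset Strict Implicit.
Unset Printing Implicit Defensive.

Import Order.TTheory GRing.Theory Num.Theory.

Local Open Scope classical_set_scope.
Local Open Scope ring_scope.

Section Polytopes.
Context {R : realType} {n : nat}.
Implicit Types (A F G Q : set 'rV[R]_n) (u v z : 'rV[R]_n).

Definition dot u v : R := \sum_j u 0 j * v 0 j.

Definition hull A : set 'rV[R]_n :=
  smallest (@convex_set R 'rV[R]_n) A.

Definition affhull A : set 'rV[R]_n :=
  [set z | exists (r : nat) (p : 'I_r -> 'rV[R]_n) (c : 'I_r -> R),
     [/\ forall l, A (p l), \sum_l c l = 1 & z = \sum_l c l *: p l]].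

Definition affindep (r : nat) (p : 'I_r -> 'rV[R]_n) : Prop :=
  forall c : 'I_r -> R,
    \sum_l c l = 0 -> \sum_l c l *: p l = 0 -> forall l, c l = 0.

(* One less than the maximal number of affinely independent points of A.
   In 'rV_n there are never more than n + 1 such points, whence the range of
   r; in particular affdim set0 = -1. *)
Definition affdim A : int :=
  (\max_(r < n.+2 | `[< exists p : 'I_r -> 'rV[R]_n,
                          affindep p /\ (forall l, A (p l)) >]) (r : nat))%:Z - 1.

Definition polytope Q : Prop := exists s : seq 'rV[R]_n, Q = hull [set` s].

(* u = 0 is allowed: it yields the improper faces Q (c = 0) and set0 (c = 1). *)
Definition face Q F : Prop :=
  exists (u : 'rV[R]_n) (c : R),
    (forall z, Q z -> dot u z <= c) /\ F = Q `&` [set z | dot u z = c].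

Definition proper_face Q F : Prop := face Q F /\ F <> Q.

Definition facet Q F : Prop := face Q F /\ affdim F = affdim Q - 1.

Definition vertices Q : set 'rV[R]_n := [set v | face Q [set v]].

(* Meaningful for polytopes, whose vertex set is finite. *)
Definition nvertices Q : nat := #|` fset_set (vertices Q)|%fset.

(* Q is a neighbourly d-polytope. *)
Definition neighbourly (d : nat) Q : Prop :=
  [/\ polytope Q, affdim Q = d%:Z
    & forall S : {fset 'rV[R]_n},
        [set` S] `<=` vertices Q -> #|` S|%fset = d./2 ->
        exists2 F, proper_face Q F & vertices F = [set` S]].

End Polytopes.

(* L is a realisation of the quotient polytope Q/G: the face lattice of L is
   isomorphic to the interval [G, Q] of the face lattice of Q. *)
Definition quotient_polytope (R : realType) (n e : nat)
    (Q G : set 'rV[R]_n) (L : set 'rV[R]_e) : Prop :=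
  [/\ polytope L,
      affdim L = affdim Q - affdim G - 1
    & exists f : set 'rV[R]_e -> set 'rV[R]_n,
        set_bij [set F | face L F] [set F | face Q F /\ G `<=` F] f /\
        (forall F1 F2, face L F1 -> face L F2 ->
           (F1 `<=` F2 <-> f F1 `<=` f F2))].

Section Sewing.
Context {R : realType} {n : nat}.
Implicit Types (F Q U H : set 'rV[R]_n) (z : 'rV[R]_n).

(* U belongs to U_k(Q); only used for neighbourly Q. *)
Definition universal (k : nat) Q U : Prop :=
  [/\ face Q U, affdim U = k%:Z
    & facet Q U \/
      exists (e d : nat) (L : set 'rV[R]_e),
        [/\ quotient_polytope Q U L, neighbourly d L
          & (nvertices L + k.+1 = nvertices Q)%N]].

(* The hyperplane H separates z from Q (weakly; below z is never on H). *)
Definition separates H Q z : Prop :=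
  exists (u : 'rV[R]_n) (c : R),
    [/\ u != 0, H = [set w | dot u w = c],
        (forall w, Q w -> dot u w <= c) & c <= dot u z].

Definition beyond Q F z : Prop :=
  ~ affhull F z /\ separates (affhull F) Q z.

Definition beneath Q F z : Prop :=
  ~ affhull F z /\ ~ separates (affhull F) Q z.

(* The sequences x and y are indexed from 1; only the values x_1, ..., x_m and
   y_1, ..., y_m are relevant. *)
Variables (m : nat) (x y : nat -> 'rV[R]_n).

Fixpoint Phi (j : nat) : set 'rV[R]_n :=
  if j is j'.+1 then hull (Phi j' `|` [set x j; y j]) else set0.

Definition universal_tower (P : set 'rV[R]_n) : Prop :=
  [/\ uniq ([seq x j | j <- iota 1 m] ++ [seq y j | j <- iota 1 m]),
      forall j, (1 <= j <= m)%N -> vertices P (x j) /\ vertices P (y j)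
    & forall j, (1 <= j <= m)%N -> universal (2 * j - 1)%N P (Phi j)].

Definition tower_facets (P : set 'rV[R]_n) (j : nat) : set (set 'rV[R]_n) :=
  [set F | [/\ (j <= m)%N, facet P F & Phi j `<=` F]].

Definition tower_C (P : set 'rV[R]_n) : set (set 'rV[R]_n) :=
  \bigcup_(j in [set j | odd j]) (tower_facets P j `\` tower_facets P j.+1).

Definition exactly_beyond (P : set 'rV[R]_n) (C : set (set 'rV[R]_n)) z : Prop :=
  forall F, facet P F ->
    (C F -> beyond P F z) /\ (~ C F -> beneath P F z).

Definition sewn (P : set 'rV[R]_n) (xbar : 'rV[R]_n) (Pplus : set 'rV[R]_n) :
    Prop :=
  exactly_beyond P (tower_C P) xbar /\ Pplus = hull (P `|` [set xbar]).

End Sewing.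

(* Main.v *)
(* Index the vertices of a polytope by a finite type and describe a face by the
   set of its vertices: a set S is exposed if some affine functional, nonpositive
   on the polytope, vanishes exactly at the vertices in S. In a simplicial
   2m-polytope a face with vertex set S, #|S| = 2k, is universal iff S together
   with any m - k further vertices is exposed. By Radon's theorem any 2m + 1
   vertices of P are affinely independent. The faces of Pplus are those of P lying
   in a facet beneath xbar, and the joins with xbar of those lying both in a
   facet beneath and in a facet beyond xbar; this follows from the fact that the
   functionals supporting a face are generated by those of the facets containing it.

   A facet containing U but not x_{i+1} contains Phi_i but not Phi_{i+1}, so it is
   beyond xbar iff i is odd. Let U be universal in Pplus. If i were odd, U together
   with any m - k vertices would span a face with x_{i+1}, which Radon's theorem
   forbids since P has more than 2m + 1 vertices. So i is even, and every face of P
   that contains U and lies in a facet beyond xbar lies there with x_{i+1}; this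
   gives the universality of [U, xbar, x_{i+1}]. Conversely, if i is even,
   a face containing U but not x_{i+1} lies in a facet avoiding x_{i+1}, which is
   beneath xbar, and in all other cases the face in question is contained in one
   through [U, xbar, x_{i+1}]. *)
Require Import Defs.
From mathcomp Require Import all_boot all_order all_algebra finmap.
From mathcomp Require Import boolp classical_sets functions cardinality.
From mathcomp Require Import interval_inference reals convex.
From mathcomp Require Import ring lra zify.

Set Implicit Arguments.
Unset Strict Implicit.
Unset Printing Implicit Defensive.

Import Order.TTheory GRing.Theory Num.Theory.

Local Open Scope classical_set_scope.
Local Open Scope ring_scope.

(** * Affine functionals and affine independence *)

Section Dot.
Context {R : realType} {n : nat}.
Implicit Types (u z : 'rV[R]_n).

Lemma dotDr u z1 z2 : dot u (z1 + z2) = dot u z1 + dot u z2.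
Proof. by rewrite -big_split; apply: eq_bigr => j _; rewrite mxE mulrDr. Qed.

Lemma dotZr u a z : dot u (a *: z) = a * dot u z.
Proof.
by rewrite mulr_sumr; apply: eq_bigr => j _; rewrite mxE mulrCA.
Qed.

Lemma dotC u z : dot u z = dot z u.
Proof. by apply: eq_bigr => j _; rewrite mulrC. Qed.

Lemma dotDl u1 u2 z : dot (u1 + u2) z = dot u1 z + dot u2 z.
Proof. by rewrite dotC dotDr !(dotC z). Qed.

Lemma dotZl u a z : dot (a *: u) z = a * dot u z.
Proof. by rewrite dotC dotZr (dotC z). Qed.

Lemma dotNr u z : dot u (- z) = - dot u z.
Proof. by rewrite -scaleN1r dotZr mulN1r. Qed.

Lemma dotNl u z : dot (- u) z = - dot u z.
Proof. by rewrite dotC dotNr dotC. Qed.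

Lemma dot0r u : dot u 0 = 0.
Proof. by rewrite /dot big1 // => j _; rewrite mxE mulr0. Qed.

Lemma dot0l u : dot 0 u = 0.
Proof. by rewrite dotC dot0r. Qed.

Lemma dot_sumr (I : finType) u (c : I -> R) (p : I -> 'rV[R]_n) :
  dot u (\sum_i c i *: p i) = \sum_i c i * dot u (p i).
Proof.
rewrite (big_morph (dot u) (dotDr u) (dot0r u)).
by apply: eq_bigr => i _; rewrite dotZr.
Qed.

Definition affine (f : 'rV[R]_n -> R) : Prop :=
  exists (u : 'rV[R]_n) (c : R), forall z, f z = dot u z - c.

Lemma affineD f g : affine f -> affine g -> affine (fun z => f z + g z).
Proof.
move=> [u [c fE]] [w [d gE]]; exists (u + w), (c + d) => z.
by rewrite fE gE dotDl; ring.
Qed.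

Lemma affineZ a f : affine f -> affine (fun z => a * f z).
Proof.
move=> [u [c fE]]; exists (a *: u), (a * c) => z.
by rewrite fE dotZl; ring.
Qed.

Lemma affine_cst a : affine (fun=> a).
Proof. by exists 0, (- a) => z; rewrite dot0l opprK add0r. Qed.

Lemma affineN f : affine f -> affine (fun z => - f z).
Proof.
move=> [u [c fE]]; exists (- u), (- c) => z.
by rewrite fE -scaleN1r dotZl; ring.
Qed.

Lemma affine_sum (I : finType) (h : I -> 'rV[R]_n -> R) (a : I -> R) :
  (forall i, affine (h i)) -> affine (fun z => \sum_i a i * h i z).
Proof.
move=> /choice[u /choice[c hE]].
exists (\sum_i a i *: u i), (\sum_i a i * c i) => z.
rewrite dotC dot_sumr -sumrB; apply: eq_bigr => i _.
by rewrite hE dotC; ring.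
Qed.

(** The last term measures how far the coefficients are from summing to 1. Sum 1 gives the usual
    affine identity; sum 0 with vanishing combination makes the two terms cancel. *)
Lemma affine_comb f (I : finType) (c : I -> R) (p : I -> 'rV[R]_n) :
  affine f ->
  \sum_i c i * f (p i) = f (\sum_i c i *: p i) + (\sum_i c i - 1) * f 0.
Proof.
move=> [u [d fE]]; rewrite !fE dot0r dot_sumr.
under eq_bigr => i _ do rewrite fE mulrBr.
by rewrite sumrB -mulr_suml; ring.
Qed.

Lemma affine_comb1 f (I : finType) (c : I -> R) (p : I -> 'rV[R]_n) :
  affine f -> \sum_i c i = 1 ->
  f (\sum_i c i *: p i) = \sum_i c i * f (p i).
Proof. by move=> /affine_comb -> ->; rewrite subrr mul0r addr0. Qed.

Lemma affine_comb0 f (I : finType) (c : I -> R) (p : I -> 'rV[R]_n) :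
  affine f -> \sum_i c i = 0 -> \sum_i c i *: p i = 0 ->
  \sum_i c i * f (p i) = 0.
Proof. by move=> /affine_comb -> -> ->; rewrite sub0r mulN1r subrr. Qed.

Lemma affine_seg f t z1 z2 : affine f ->
  f (t *: z1 + (1 - t) *: z2) = t * f z1 + (1 - t) * f z2.
Proof. by move=> [u [c fE]]; rewrite !fE dotDr !dotZr; ring. Qed.

(** In homogeneous coordinates an affine functional is a column vector whose last entry is the
    constant term. Functionals found by matrix algebra enter through this lemma. *)
Lemma affine_mx (x : 'cV[R]_(n + 1)) :
  affine (fun z => (row_mx z 1%:M *m x) 0 0).
Proof.
exists (\row_j x (lshift 1 j) 0), (- x (rshift n 0) 0) => z.
rewrite -[x in LHS]vsubmxK mul_row_col mul1mx !mxE opprK; congr (_ + _).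
by apply: eq_bigr => j _; rewrite !mxE mulrC.
Qed.

End Dot.

Lemma mulmx_kernel (R : fieldType) (r s : nat) (C : 'M[R]_(r, s)) :
  (s < r)%N -> exists2 c : 'rV[R]_r, c != 0 & c *m C = 0.
Proof.
move=> sr; exists (nz_row (kermx C)); last first.
  by apply/sub_kermxP; exact: nz_row_sub.
by rewrite nz_row_eq0 -mxrank_eq0 mxrank_ker subn_eq0 -ltnNge
  (leq_ltn_trans (rank_leq_col C)).
Qed.

Lemma sum_option (W : nmodType) (I : finType) (F : option I -> W) :
  \sum_o F o = F None + \sum_i F (Some i).
Proof.
rewrite (bigD1 None) //=; congr (_ + _).
rewrite [RHS](_ : _ = \sum_(i in [set: I]%SET) F (Some i)); last first.
  by apply: eq_bigl => i; rewrite inE.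
rewrite -(@big_imset _ _ _ _ _ Some) /=; last by move=> i j _ _ [].
apply: eq_bigl => -[i|] /=; first by apply/esym/imsetP; exists i.
by apply/esym/negP => /imsetP[].
Qed.

Section Independence.
Context {R : realType} {n : nat}.

Definition supported (I : finType) (S : {set I}) (c : I -> R) : Prop :=
  forall i, i \notin S -> c i = 0.

(** Coefficients are functions on all of [I] vanishing outside [S], so that different index sets can
    be compared without reindexing. *)
Definition indep (I : finType) (v : I -> 'rV[R]_n) (S : {set I}) : Prop :=
  forall c, supported S c -> \sum_i c i = 0 -> \sum_i c i *: v i = 0 ->
  forall i, c i = 0.

Section Extend.
Variables (I : finType) (S : {set I}).

(** The sum has at most one term, and none outside [S]: this is extension by zero. *)
Definition extend (c : 'I_#|S| -> R) (i : I) : R :=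
  \sum_(l | enum_val l == i) c l.

Lemma extend_supported c : supported S (extend c).
Proof.
move=> i iS; rewrite /extend big_pred0 // => l.
by apply: contraNF iS => /eqP <-; exact: enum_valP.
Qed.

Lemma extend_enum_val c l : extend c (enum_val l) = c l.
Proof.
rewrite /extend (big_pred1 l) // => l'.
by rewrite (inj_eq enum_val_inj).
Qed.

Lemma sum_extend (W : lmodType R) (c : 'I_#|S| -> R) (w : I -> W) :
  \sum_i extend c i *: w i = \sum_l c l *: w (enum_val l).
Proof.
rewrite [RHS](partition_big (@enum_val _ (mem S)) xpredT) //=.
apply: eq_bigr => i _; rewrite scaler_suml.
by apply: eq_bigr => l /eqP ->.
Qed.

Lemma sum_extend1 (c : 'I_#|S| -> R) : \sum_i extend c i = \sum_l c l.
Proof.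
have := @sum_extend R^o c (fun=> 1).
by under eq_bigr do rewrite [_ *: _]mulr1;
   under [RHS]eq_bigr do rewrite [_ *: _]mulr1.
Qed.

Lemma sum_supported (W : lmodType R) (c : I -> R) (w : I -> W) :
  supported S c ->
  \sum_i c i *: w i = \sum_(l < #|S|) c (enum_val l) *: w (enum_val l).
Proof.
move=> cS; rewrite -(sum_extend (fun l => c (enum_val l))).
apply: eq_bigr => i _; congr (_ *: _).
have [iS|iS] := boolP (i \in S); last by rewrite cS ?extend_supported.
by rewrite -[in RHS](enum_rankK_in iS iS) extend_enum_val enum_rankK_in.
Qed.

Lemma sum_supported1 (c : I -> R) :
  supported S c -> \sum_i c i = \sum_(l < #|S|) c (enum_val l).
Proof.
move=> /(@sum_supported R^o _ (fun=> 1)).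
by under eq_bigr do rewrite [_ *: _]mulr1;
   under [X in _ = X -> _]eq_bigr do rewrite [_ *: _]mulr1.
Qed.

End Extend.

(** Homogeneous coordinates as rows: the left kernel consists of the affine dependences, the right
    multiplications are evaluations of affine functionals. *)
Definition homog (I : finType) (v : I -> 'rV[R]_n) (S : {set I}) :
    'M[R]_(#|S|, n + 1) :=
  \matrix_l row_mx (v (enum_val l)) 1%:M.

Lemma mul_homog (I : finType) (v : I -> 'rV[R]_n) (S : {set I})
    (c : 'rV[R]_#|S|) :
  c *m homog v S =
  row_mx (\sum_l c 0 l *: v (enum_val l)) (\sum_l c 0 l)%:M.
Proof.
rewrite mulmx_sum_row.
under eq_bigr => l _ do rewrite rowK scale_row_mx.
apply/rowP => j; rewrite summxE [RHS]mxE; case: split_ordP => k ->.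
  by rewrite summxE; apply: eq_bigr => l _; rewrite row_mxEl.
rewrite !mxE !ord1 eqxx mulr1n; apply: eq_bigr => l _.
by rewrite row_mxEr !mxE mulr1.
Qed.

Lemma homog_ker (I : finType) (v : I -> 'rV[R]_n) (S : {set I})
    (c : 'rV[R]_#|S|) :
  c *m homog v S = 0 <->
  \sum_i extend (c 0) i = 0 /\ \sum_i extend (c 0) i *: v i = 0.
Proof.
rewrite mul_homog sum_extend sum_extend1; split.
  rewrite -row_mx0 => /eq_row_mx[-> /(congr1 (fun A : 'M_1 => A 0 0))].
  by rewrite !mxE eqxx mulr1n.
by move=> [-> ->]; rewrite raddf0 row_mx0.
Qed.

Lemma affine_dependence (I : finType) (v : I -> 'rV[R]_n) (S : {set I}) :
  (n.+1 < #|S|)%N ->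
  exists c : I -> R,
    [/\ supported S c, \sum_i c i = 0, \sum_i c i *: v i = 0
      & exists i, c i != 0].
Proof.
rewrite -addn1 => /(mulmx_kernel (homog v S))[c /rV0Pn[l cl] /homog_ker[c0 cv]].
exists (extend (c 0)); split => //; first exact: extend_supported.
by exists (enum_val l); rewrite extend_enum_val.
Qed.

Lemma indep_card (I : finType) (v : I -> 'rV[R]_n) S :
  indep v S -> (#|S| <= n.+1)%N.
Proof.
move=> vS; rewrite leqNgt; apply/negP => /(affine_dependence v)[c].
by move=> [cS c0 cv [i /eqP]]; apply; exact: vS.
Qed.

(** Independence makes [homog v S] row free, and a right inverse applied to the column of prescribed
    values yields the functional. *)
Lemma indep_affine (I : finType) (v : I -> 'rV[R]_n) S (t : I -> R) :
  indep v S ->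
  exists2 f, affine f & forall i, i \in S -> f (v i) = t i.
Proof.
move=> vS; have /row_freeP[B AB] : row_free (homog v S).
  apply: inj_row_free => c /homog_ker[c0 cv]; apply/rowP => l.
  rewrite mxE -[c 0 l](extend_enum_val (c 0)).
  by apply: vS => //; exact: extend_supported.
pose y := B *m \col_(l < #|S|) t (enum_val l).
exists (fun z => (row_mx z 1%:M *m y) 0 0); first exact: affine_mx.
move=> i iS; rewrite -(enum_rankK_in iS iS); set l := enum_rank_in _ _.
have -> : row_mx (v (enum_val l)) 1%:M = row l (homog v S) by rewrite rowK.
by rewrite -row_mul mulmxA AB mul1mx !mxE.
Qed.

(** At most [n] linear conditions on the [n + 1] coefficients of a functional leave a nonzero
    solution. *)
Lemma affine_vanishing (I : finType) (v : I -> 'rV[R]_n) (S : {set I}) :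
  (#|S| <= n)%N ->
  exists2 f, affine f &
    (exists z, f z != 0) /\ forall i, i \in S -> f (v i) = 0.
Proof.
rewrite -ltnS -[X in (_ < X)%N]addn1 => /(mulmx_kernel (homog v S)^T)[c c0 cS].
exists (fun z => (row_mx z 1%:M *m c^T) 0 0); first exact: affine_mx.
split.
  (* The value at the origin recovers the constant term, the values at the unit vectors the
     remaining coefficients; a functional vanishing everywhere thus has [c = 0]. *)
  apply: contrapT => /forallNP f0; move/eqP: c0; apply.
  have {}f0 z : (row_mx z 1%:M *m c^T) 0 0 = 0.
    by apply/eqP; apply: contrapT => /negP; exact: f0.
  have cE z : (row_mx z 1%:M *m c^T) 0 0 =
      \sum_j z 0 j * c 0 (lshift 1 j) + c 0 (rshift n 0).
    rewrite -[c in LHS]hsubmxK tr_row_mx mul_row_col mul1mx !mxE.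
    by congr (_ + _); apply: eq_bigr => j _; rewrite !mxE.
  have c1 : c 0 (rshift n 0) = 0.
    rewrite -[RHS](f0 0) cE big1 ?add0r // => j _.
    by rewrite mxE mul0r.
  apply/rowP => j; rewrite mxE; case: (split_ordP j) => k ->;
    last by rewrite ord1.
  rewrite -[RHS](f0 (delta_mx 0 k)) cE c1 addr0 (bigD1 k) //= big1 ?addr0.
    by rewrite mxE !eqxx mul1r.
  by move=> j' /negbTE j'k; rewrite mxE j'k andbF mul0r.
move=> i iS; rewrite -(enum_rankK_in iS iS); set l := enum_rank_in _ _.
have -> : row_mx (v (enum_val l)) 1%:M = row l (homog v S) by rewrite rowK.
rewrite -[homog v S]trmxK -tr_col -trmx_mul mxE.
by rewrite colE mulmxA cS mul0mx mxE.
Qed.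

(** Adjoining [z] under the index [None] gives [n + 2] points, hence a dependence. Its coefficient
    at [z] is nonzero by independence of [S], and dividing by it solves for [z]. *)
Lemma indep_span (I : finType) (v : I -> 'rV[R]_n) S (z : 'rV[R]_n) :
  indep v S -> #|S| = n.+1 ->
  exists c, [/\ supported S c, \sum_i c i = 1 & z = \sum_i c i *: v i].
Proof.
move=> vS Sn; pose w o := if o is Some i then v i else z.
pose T : {set option I} := None |: [set Some i | i in S]%SET.
have T1 : (n.+1 < #|T|)%N.
  have NS : None \notin [set Some i | i in S]%SET by apply/imsetP => -[].
  have SI : injective (@Some I) by move=> i j [].
  by rewrite cardsU1 NS (card_imset _ SI) Sn.
have [c [cT c0 cw [o co]]] := affine_dependence w T1.
rewrite sum_option /= in c0; rewrite sum_option /= in cw.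
have cS i : i \notin S -> c (Some i) = 0.
  move=> iS; apply: cT; rewrite !inE /=; apply: contra iS => /imsetP[j jS [->]].
  exact: jS.
have cN : c None != 0.
  apply/eqP => cN; rewrite cN scale0r !add0r in c0 cw.
  have ci := vS (fun i => c (Some i)) cS c0 cw.
  by case: o co => [i|]; rewrite ?ci ?cN eqxx.
exists (fun i => - (c None)^-1 * c (Some i)); split.
- by move=> i /cS ->; rewrite mulr0.
- rewrite -mulr_sumr; move/eqP: c0; rewrite addrC addr_eq0 => /eqP ->.
  by rewrite mulrNN mulVf.
- under eq_bigr do rewrite -scalerA.
  rewrite -scaler_sumr; move/eqP: cw; rewrite addrC addr_eq0 => /eqP ->.
  by rewrite scalerN scaleNr opprK scalerA mulVf ?scale1r.
Qed.

Lemma affine_eq0 (I : finType) (v : I -> 'rV[R]_n) S f :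
  indep v S -> #|S| = n.+1 -> affine f -> (forall i, i \in S -> f (v i) = 0) ->
  forall z, f z = 0.
Proof.
move=> vS Sn af f0 z; have [c [cS c1 ->]] := indep_span z vS Sn.
rewrite affine_comb1 // big1 // => i _.
by have [/f0 ->|/cS ->] := boolP (i \in S); rewrite ?mulr0 ?mul0r.
Qed.

(** Applying [f] to a dependence leaves only the term at [i0], whose coefficient must therefore
    vanish. *)
Lemma indepU1 (I : finType) (v : I -> 'rV[R]_n) S f i0 :
  indep v S -> affine f -> (forall i, i \in S -> f (v i) = 0) ->
  f (v i0) != 0 -> indep v (i0 |: S).
Proof.
move=> vS af f0 fi0 c cS c0 cv; apply: vS => // i iS.
have [->|ii0] := eqVneq i i0; last by apply: cS; rewrite !inE negb_or ii0.
have := affine_comb0 af c0 cv; rewrite (bigD1 i0) //= big1.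
  by rewrite addr0 => /eqP; rewrite mulf_eq0 (negbTE fi0) orbF => /eqP.
move=> j ji0; have [/f0 ->|jS] := boolP (j \in S); rewrite ?mulr0 //.
by rewrite cS ?mul0r // !inE negb_or ji0.
Qed.

Lemma affdim_ge (A : set 'rV[R]_n) r :
  (r <= n.+1)%N ->
  (exists p : 'I_r -> 'rV[R]_n, affindep p /\ (forall l, A (p l))) ->
  r%:Z - 1 <= affdim A.
Proof.
move=> rn pA; rewrite /affdim lerD2r lez_nat.
pose r' : 'I_n.+2 := Ordinal (rn : (r < n.+2)%N).
by apply: (@leq_bigmax_cond _ _ (fun r : 'I_n.+2 => nat_of_ord r) r');
  apply/asboolP.
Qed.

Lemma affdim_wit (A : set 'rV[R]_n) (r : nat) : affdim A = r%:Z - 1 ->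
  exists p : 'I_r -> 'rV[R]_n, affindep p /\ (forall l, A (p l)).
Proof.
rewrite /affdim => /addIr [].
set a := (X in X = r); suff : `[< exists p : 'I_a -> 'rV[R]_n,
  affindep p /\ (forall l, A (p l)) >] by move=> /asboolP + <-.
(* The maximum is attained: a maximum of two numbers is one of them, and the initial value 0 is
   realised by the empty family. *)
rewrite {}/a; elim/big_rec : _ => [|i x Pi IH].
  apply/asboolP; have p0 : 'I_0 -> 'rV[R]_n by case.
  by exists p0; split => [c _ _|] [].
by rewrite /maxn; case: ifP.
Qed.

Lemma affdim_le (A B : set 'rV[R]_n) : A `<=` B -> affdim A <= affdim B.
Proof.
move=> AB; have [r rn rA] : exists2 r, (r <= n.+1)%N & affdim A = r%:Z - 1.
  rewrite /affdim; eexists; last by [].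
  by apply/bigmax_leqP => r _; rewrite -ltnS.
rewrite rA; apply: affdim_ge => //.
have [p [ip pA]] := affdim_wit rA.
by exists p; split => // l; apply: AB.
Qed.

Lemma affdim_max (A : set 'rV[R]_n) : affdim A <= n%:Z.
Proof.
rewrite /affdim lerBlDr -[1]/(1%:Z) -PoszD lez_nat addn1.
by apply/bigmax_leqP => r _; rewrite -ltnS.
Qed.

(** More than [#|S|] points of [A] have linearly dependent coordinate rows. As each row sums to 1, a
    vanishing combination of rows is an affine dependence of the points. *)
Lemma affdim_indep (I : finType) (v : I -> 'rV[R]_n) S (A : set 'rV[R]_n) :
  indep v S -> (forall i, i \in S -> A (v i)) ->
  (forall z, A z ->
    exists c, [/\ supported S c, \sum_i c i = 1 & z = \sum_i c i *: v i]) ->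
  affdim A = #|S|%:Z - 1.
Proof.
move=> vS SA Aspan; apply/le_anti/andP; split; last first.
  apply: affdim_ge; first exact: indep_card vS.
  exists (fun l => v (enum_val l)); split => [c c0 cv l|l]; last first.
    by apply: SA; exact: enum_valP.
  rewrite -(extend_enum_val c); apply: vS; rewrite ?sum_extend1 ?sum_extend //.
  exact: extend_supported.
rewrite /affdim lerD2r lez_nat; apply/bigmax_leqP => r /asboolP[p [ip pA]].
rewrite leqNgt; apply/negP => Sr.
have /choice[c cP] l := Aspan _ (pA l).
have [d d0 dC] :=
  mulmx_kernel (\matrix_(l < r, j < #|S|) c l (enum_val j)) Sr.
have dc i : \sum_l d 0 l * c l i = 0.
  have [iS|iS] := boolP (i \in S); last first.
    by rewrite big1 // => l _; have [-> //] := cP l; rewrite mulr0.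
  have /rowP/(_ (enum_rank_in iS i)) := dC; rewrite !mxE => {2}<-.
  by apply: eq_bigr => l _; rewrite !mxE enum_rankK_in.
case/rV0Pn: d0 => l; rewrite (ip (d 0)) ?eqxx //.
  transitivity (\sum_i \sum_l d 0 l * c l i); last by rewrite big1.
  rewrite exchange_big; apply: eq_bigr => k _ /=; rewrite -mulr_sumr.
  by have [_ -> _] := cP k; rewrite mulr1.
transitivity (\sum_i (\sum_l d 0 l * c l i) *: v i); last first.
  by rewrite big1 // => i _; rewrite dc scale0r.
under [RHS]eq_bigr do rewrite scaler_suml.
rewrite exchange_big; apply: eq_bigr => k _ /=.
have [_ _ {1}->] := cP k; rewrite scaler_sumr.
by apply: eq_bigr => i _; rewrite scalerA.
Qed.

End Independence.

(** * Convex hulls of finite families *)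

Section Hull.
Context {R : realType} {n : nat}.

Lemma convex_setP (A : set 'rV[R]_n) :
  @convex_set R 'rV[R]_n A <->
  forall z1 z2 t, 0 <= t <= 1 -> A z1 -> A z2 -> A (t *: z1 + (1 - t) *: z2).
Proof.
split=> [cA z1 z2 t /andP[t0 t1] A1 A2|cA z1 z2 t /set_mem A1 /set_mem A2].
  have /set_mem := cA z1 z2 (Itv01 t0 t1) (mem_set A1) (mem_set A2).
  by rewrite /conv /=.
by apply/mem_set; rewrite /conv /=; apply: cA => //; rewrite ge0 le1.
Qed.

Lemma sub_hull (A : set 'rV[R]_n) : A `<=` hull A.
Proof. exact: sub_gen_smallest. Qed.

Lemma convex_hull (A : set 'rV[R]_n) : @convex_set R 'rV[R]_n (hull A).
Proof.
apply/convex_setP => z1 z2 t t01 h1 h2 B [cB AB].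
by move/convex_setP : (cB); apply => //; [apply: h1|apply: h2].
Qed.

Lemma hull_subset (A B : set 'rV[R]_n) :
  @convex_set R 'rV[R]_n B -> A `<=` B -> hull A `<=` B.
Proof. exact: smallest_sub. Qed.

Lemma hull_id (A : set 'rV[R]_n) :
  @convex_set R 'rV[R]_n A -> hull A = A.
Proof. exact: smallest_id. Qed.

Lemma hullS (A B : set 'rV[R]_n) : A `<=` B -> hull A `<=` hull B.
Proof.
by move=> AB; apply: hull_subset; [exact: convex_hull|move=> z /AB /sub_hull].
Qed.

Lemma hull_hullU (A B : set 'rV[R]_n) : hull (hull A `|` B) = hull (A `|` B).
Proof.
apply/seteqP; split; last by apply: hullS; apply: setSU; exact: sub_hull.
apply: hull_subset; first exact: convex_hull.
move=> z [|Bz]; last by apply: sub_hull; right.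
by apply: hullS => {}z Az; left.
Qed.

Lemma hull0 : hull (classical_sets.set0 : set 'rV[R]_n) = classical_sets.set0.
Proof. by apply: hull_id => z1 z2 t /set_mem. Qed.

Lemma hull1 (z : 'rV[R]_n) : hull [set z] = [set z].
Proof.
apply: hull_id; apply/convex_setP => z1 z2 t _ -> -> /=.
by rewrite -scalerDl addrCA subrr addr0 scale1r.
Qed.

Section FiniteHull.
Context {I : finType}.
Implicit Types (v : I -> 'rV[R]_n) (S T : {set I}).

Definition chull v S : set 'rV[R]_n := hull (v @` [set i | i \in S]).

Lemma mem_chull v S i : i \in S -> chull v S (v i).
Proof. by move=> iS; apply: sub_hull; exists i. Qed.

Lemma chullS v S T : S \subset T -> chull v S `<=` chull v T.
Proof.
move=> /fintype.subsetP ST; apply: hullS => _ [i iS <-].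
by exists i => //; exact: ST.
Qed.

(** Induction on the number of nonzero coefficients: one point is split off and the remaining
    coefficients are rescaled to sum 1. A coefficient equal to 1 is treated apart, since rescaling
    would divide by zero. *)
Lemma convex_comb (A : set 'rV[R]_n) v (c : I -> R) :
  @convex_set R 'rV[R]_n A -> (forall i, 0 <= c i) -> \sum_i c i = 1 ->
  (forall i, c i != 0 -> A (v i)) -> A (\sum_i c i *: v i).
Proof.
move=> /convex_setP cA; move: {2}#|_| (leqnn #|[set i | c i != 0]%SET|) => k.
elim: k c => [|k IH] c ck c0 c1 cv.
  move: ck; rewrite leqn0 cards_eq0 => /eqP/finset.setP c00.
  have : \sum_i c i = 0.
    by rewrite big1 // => i _; move/(_ i): c00; rewrite !inE => /negbFE/eqP.
  by rewrite c1 => /eqP; rewrite oner_eq0.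
have [i ci] : exists i, c i != 0.
  apply: contrapT => /forallNP c00; have : \sum_i c i = 0.
    by rewrite big1 // => i _; apply/eqP; apply: contrapT => /negP; apply: c00.
  by rewrite c1 => /eqP; rewrite oner_eq0.
have c1' : 1 - c i = \sum_(j | j != i) c j
  by rewrite -c1 (bigD1 i) //= addrAC subrr add0r.
have ci_le1 : 0 <= c i <= 1 by rewrite c0 -subr_ge0 c1' sumr_ge0.
have [ci1|ci1] := eqVneq (1 - c i) 0.
  have cj j : j != i -> c j = 0.
    by move=> ji; apply: (psumr_eq0P _ (esym (etrans (esym ci1) c1'))).
  rewrite (bigD1 i) //= big1 ?addr0 => [|j /cj ->]; last by rewrite scale0r.
  by move/eqP: ci1; rewrite subr_eq0 => /eqP <-; rewrite scale1r; apply: cv.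
rewrite (_ : \sum_j _ = c i *: v i + (1 - c i) *:
    \sum_j (if j == i then 0 else (1 - c i)^-1 * c j) *: v j); last first.
  rewrite (bigD1 i) //=; congr (_ + _); rewrite [in RHS](bigD1 i) //= eqxx.
  rewrite scale0r add0r scaler_sumr; apply: eq_bigr => j /negbTE ->.
  by rewrite scalerA mulrA mulfV // mul1r.
apply: cA => //; first exact: cv.
apply: IH => [|j||j].
- have : [set j | (if j == i then 0 else (1 - c i)^-1 * c j) != 0]%SET \subset
      [set j | c j != 0]%SET :\ i.
    apply/fintype.subsetP => j; rewrite !inE.
    have [_|ji] := eqVneq j i; first by rewrite eqxx.
    by apply: contra => /eqP ->; rewrite mulr0.
  move=> /subset_leq_card /leq_trans; apply; rewrite -ltnS; apply: leq_trans ck.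
  by rewrite [leqRHS](cardsD1 i) inE ci.
- have [_|_] := eqVneq j i; rewrite ?mulr_ge0 // invr_ge0 subr_ge0.
  by case/andP: ci_le1.
- rewrite (bigD1 i) //= eqxx add0r; transitivity ((1 - c i)^-1 * (1 - c i)).
    by rewrite [X in _ * X]c1' mulr_sumr; apply: eq_bigr => j /negbTE ->.
  by rewrite mulVf.
- have [_|_ cj] := eqVneq j i; first by rewrite eqxx.
  by apply: cv; apply: contra cj => /eqP ->; rewrite mulr0.
Qed.

Lemma chullP v S z :
  chull v S z <->
  exists c : I -> R, [/\ forall i, 0 <= c i, supported S c, \sum_i c i = 1
                       & z = \sum_i c i *: v i].
Proof.
split; last first.
  move=> [c [c0 cS c1 ->]]; apply: convex_comb => //; first exact: convex_hull.
  move=> i ci; apply: mem_chull; apply: contraNT ci => iS.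
  by rewrite cS.
move: z; apply: hull_subset.
  apply/convex_setP => z1 z2 t /andP[t0 t1] [c [c0 cS c1 ->]] [d [d0 dS d1 ->]].
  exists (fun i => t * c i + (1 - t) * d i); split; rewrite /=.
  - by move=> i; rewrite addr_ge0 // mulr_ge0 // subr_ge0.
  - by move=> i iS; rewrite cS // dS // !mulr0 addr0.
  - by rewrite big_split /= -!mulr_sumr c1 d1 !mulr1 addrCA subrr addr0.
  - rewrite !scaler_sumr -big_split /=; apply: eq_bigr => i _.
    by rewrite [RHS]scalerDl !scalerA.
move=> _ [i iS <-]; exists (fun j => (j == i)%:R); split.
- by move=> j; case: eqP.
- by move=> j; have [->|//] := eqVneq j i; rewrite iS.
- by rewrite (bigD1 i) //= eqxx big1 ?addr0 // => j /negbTE ->.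
- rewrite (bigD1 i) //= eqxx scale1r big1 ?addr0 // => j /negbTE ->.
  by rewrite scale0r.
Qed.

Lemma affine_le_hull f (A : set 'rV[R]_n) :
  affine f -> (forall z, A z -> f z <= 0) -> forall z, hull A z -> f z <= 0.
Proof.
move=> af fA; apply: hull_subset => //; apply/convex_setP => z1 z2 t.
move=> /andP[t0 t1] f1 f2 /=; rewrite affine_seg // -oppr_ge0 opprD.
by rewrite -!mulrN addr_ge0 // mulr_ge0 // ?subr_ge0 // oppr_ge0.
Qed.

Lemma affdim_chull v S : indep v S -> affdim (chull v S) = #|S|%:Z - 1.
Proof.
move=> vS; apply: (affdim_indep vS) => [i /mem_chull //|z /chullP].
by move=> [c [_ cS c1 ->]]; exists c.
Qed.

End FiniteHull.
End Hull.

(* Bartl's proof: if the separator u of the first vectors fails on w a, project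
   along w a onto the kernel of u. *)
Lemma farkas (R : realType) (n : nat) (I : finType) (S : {set I})
    (w : I -> 'rV[R]_n) (b : 'rV[R]_n) :
  (exists c : I -> R, [/\ forall i, 0 <= c i, supported S c
                        & b = \sum_i c i *: w i]) \/
  (exists u, (forall i, i \in S -> dot u (w i) <= 0) /\ 0 < dot u b).
Proof.
move: {2}#|_| (leqnn #|S|) => k; elim: k S w b => [|k IH] S w b Sk.
  move: Sk; rewrite leqn0 cards_eq0 => /eqP ->.
  have [->|b0] := eqVneq b 0.
    left; exists (fun=> 0); split => //; rewrite big1 // => i _.
    by rewrite scale0r.
  right; exists b; split; first by move=> i; rewrite inE.
  rewrite lt_neqAle sumr_ge0 ?andbT => [|j _]; last by rewrite -expr2 sqr_ge0.
  apply: contra b0; rewrite eq_sym => /eqP/psumr_eq0P bj; apply/eqP/rowP => j.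
  have /eqP := bj (fun j _ => sqr_ge0 (b 0 j)) j isT.
  by rewrite mulf_eq0 orbb mxE => /eqP.
have [S0|[a aS]] := set_0Vmem S; first by apply: IH; rewrite S0 cards0.
have Sa : (#|S :\ a| <= k)%N by move: Sk; rewrite (cardsD1 a) aS.
have [[c [c0 cS ->]]|[u [uS ub]]] := IH (S :\ a) w b Sa.
  left; exists c; split => // i iS; apply: cS.
  by rewrite !inE (negbTE iS) andbF.
have [ua|ua] := leP (dot u (w a)) 0.
  right; exists u; split => // i iS.
  by have [->|ia] := eqVneq i a; rewrite // uS // !inE ia.
have ua0 : dot u (w a) != 0 by rewrite gt_eqF.
(* The vector [z - al z *: w a] is the projection of [z] along [w a] onto the kernel of [u]. *)
pose al z := dot u z / dot u (w a).
have [[c [c0 cS cb]]|[u' [u'S u'b]]] :=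
    IH (S :\ a) (fun i => w i - al (w i) *: w a) (b - al b *: w a) Sa.
  (* [K] collects the multiples of [w a] when the projection is undone. It is nonnegative: [al b] is
     positive, and [al (w i)] is nonpositive wherever [c i] can be nonzero. *)
  left; pose K := al b - \sum_i c i * al (w i).
  exists (fun i => c i + K * (i == a)%:R); split.
  - move=> i; rewrite addr_ge0 // mulr_ge0 // subr_ge0.
    apply: (@le_trans _ _ 0); last by rewrite /al divr_ge0 // ltW.
    rewrite -oppr_ge0 -sumrN sumr_ge0 // => j _; rewrite -mulrN.
    have [jS|/cS ->] := boolP (j \in S :\ a); last by rewrite mul0r.
    by rewrite mulr_ge0 // oppr_ge0 mulr_le0_ge0 ?uS // invr_ge0 ltW.
  - move=> i iS; rewrite cS ?inE ?(negbTE iS) ?andbF //.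
    by case: eqVneq iS aS => [->|_] iS aS; rewrite ?mulr0 ?add0r // aS in iS *.
  - under eq_bigr do rewrite scalerDl.
    rewrite big_split /= (_ : \sum_i (K * (i == a)%:R) *: w i = K *: w a).
      rewrite -[LHS](subrK (al b *: w a)) cb /K scalerBl.
      rewrite [RHS]addrCA [LHS]addrC; congr (_ + _).
      rewrite scaler_suml -sumrB; apply: eq_bigr => i _.
      by rewrite scalerBr scalerA.
    rewrite (bigD1 a) //= eqxx mulr1 big1 ?addr0 // => i /negbTE ->.
    by rewrite mulr0 scale0r.
right; exists (u' - (dot u' (w a) / dot u (w a)) *: u).
have E z : dot (u' - (dot u' (w a) / dot u (w a)) *: u) z =
    dot u' (z - al z *: w a).
  rewrite dotDl dotDr dotNl dotNr dotZl dotZr /al.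
  by rewrite mulrAC [dot u z / _ * _]mulrAC [dot u z * _]mulrC.
split=> [i iS|]; last by rewrite E.
rewrite E; have [->|ia] := eqVneq i a.
  by rewrite /al divff // scale1r subrr dot0r.
by apply: u'S; rewrite !inE ia.
Qed.

(** Farkas in homogeneous coordinates. The last coordinate of a conic representation says that the
    coefficients sum to 1, which would put [z] in the hull; the other alternative gives a
    functional, shifted here to vanish at [z]. *)
Lemma separation (R : realType) (n : nat) (I : finType) (S : {set I})
    (v : I -> 'rV[R]_n) z : ~ chull v S z ->
  exists2 f, affine f & f z = 0 /\ forall i, i \in S -> f (v i) < 0.
Proof.
move=> zS; pose h (y : 'rV[R]_n) : 'rV[R]_(n + 1) := row_mx y 1%:M.
have [[c [c0 cS]]|[u [uS uz]]] := farkas S (h \o v) (h z).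
  rewrite /h /=; under eq_bigr do rewrite scale_row_mx.
  move=> hz; case: zS; apply/chullP; exists c; split => //.
    have /rowP/(_ (rshift n 0)) := hz; rewrite summxE row_mxEr mxE eqxx mulr1n.
    move=> ->.
    by apply: eq_bigr => i _; rewrite row_mxEr !mxE eqxx mulr1.
  apply/rowP => j; have /rowP/(_ (lshift 1 j)) := hz.
  rewrite !summxE row_mxEl => ->.
  by apply: eq_bigr => i _; rewrite row_mxEl.
have [u' [d hE]] : affine (fun y => dot u (h y)).
  have [u' [d hE]] := affine_mx u^T; exists u', d => y; rewrite -hE mxE.
  by apply: eq_bigr => j _; rewrite !mxE mulrC.
exists (fun y => dot u (h y) - dot u (h z)).
  by exists u', (d + dot u (h z)) => y; rewrite hE; ring.
split; first by rewrite subrr.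
by move=> i iS; rewrite subr_lt0; apply: le_lt_trans uz; exact: uS.
Qed.

(** * Faces as exposed index sets *)

Section Faces.
Context {R : realType} {n : nat} {I : finType}.
Implicit Types (v : I -> 'rV[R]_n) (f : 'rV[R]_n -> R) (S T : {set I}).

Definition supports v f S : Prop :=
  [/\ affine f, forall i, f (v i) <= 0 & forall i, (f (v i) == 0) = (i \in S)].

Definition exposed v S : Prop := exists f, supports v f S.

Lemma supports_lt0 v f S i : supports v f S -> i \notin S -> f (v i) < 0.
Proof. by move=> [_ f0 fS] iS; rewrite lt_neqAle fS iS f0. Qed.

Lemma supports_eq0 v f S i : supports v f S -> i \in S -> f (v i) = 0.
Proof. by move=> [_ _ fS]; rewrite -fS => /eqP. Qed.

Lemma supports_le0 v f S z : supports v f S -> chull v finset.setT z -> f z <=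
  0.
Proof. by move=> [af f0 _]; apply: affine_le_hull => // _ [i _ <-]. Qed.

Lemma supports_zeros v f : affine f -> (forall i, f (v i) <= 0) ->
  supports v f [set i | f (v i) == 0]%SET.
Proof. by move=> af f0; split => // i; rewrite inE. Qed.

(** If [f] vanishes at a convex combination, the terms [c i * f (v i)] are nonpositive with sum 0,
    so each vanishes and only indices in [S] carry weight. *)
Lemma chull_supports v f S : supports v f S ->
  chull v S = chull v finset.setT `&` [set z | f z = 0].
Proof.
move=> vfS; have [af f0 fS] := vfS; apply/seteqP; split => z /=.
  move=> zS; split; first exact: (chullS (finset.subsetT S)).
  move: zS => /chullP[c [c0 cS c1 ->]]; rewrite affine_comb1 // big1 // => i _.
  have [iS|iS] := boolP (i \in S); last by rewrite cS // mul0r.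
  by rewrite (supports_eq0 vfS iS) mulr0.
move=> [/chullP[c [c0 _ c1 ->]] fz]; apply/chullP; exists c; split => // i iS.
rewrite affine_comb1 // in fz.
have cf j : - (c j * f (v j)) = 0.
  apply: (psumr_eq0P (P := xpredT) (F := fun j => - (c j * f (v j)))) => //.
    by move=> k _; rewrite oppr_ge0 mulr_ge0_le0.
  by rewrite sumrN fz oppr0.
have /eqP := cf i; rewrite oppr_eq0 mulf_eq0 => /orP[/eqP //|].
by rewrite fS (negbTE iS).
Qed.

Lemma face_supports v f S :
  supports v f S -> face (chull v finset.setT) (chull v S).
Proof.
move=> vfS; have [[u [c fE]] f0 fS] := vfS; exists u, c; split.
  by move=> z /(supports_le0 vfS); rewrite fE subr_le0.
rewrite (chull_supports vfS); congr (_ `&` _); apply/seteqP.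
by split => z /=; rewrite fE; [move/subr0_eq|move=> ->; rewrite subrr].
Qed.

Lemma exposed_face v S :
  exposed v S -> face (chull v finset.setT) (chull v S).
Proof. by move=> [f]; exact: face_supports. Qed.

Lemma face_exposed v F :
  face (chull v finset.setT) F -> exists2 S, exposed v S & F = chull v S.
Proof.
move=> [u [c [uc ->]]]; pose f z := dot u z - c.
have af : affine f by exists u, c.
have vf : supports v f [set i | f (v i) == 0]%SET.
  apply: supports_zeros => // i; rewrite subr_le0; apply: uc.
  by apply: mem_chull; rewrite inE.
exists [set i | f (v i) == 0]%SET; first by exists f.
rewrite (chull_supports vf); congr (_ `&` _); apply/seteqP.
by split => z /=; rewrite /f; [move=> ->; rewrite subrr|move/subr0_eq].
Qed.

Lemma exposed_mem v S i : exposed v S -> chull v S (v i) <-> i \in S.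
Proof.
move=> [f vfS]; split; last exact: mem_chull.
by rewrite (chull_supports vfS) => -[_ /eqP]; have [_ _ ->] := vfS.
Qed.

Lemma exposed_sub v S T : exposed v T ->
  chull v S `<=` chull v T <-> S \subset T.
Proof.
move=> vT; split; last exact: chullS.
move=> ST; apply/fintype.subsetP => i iS; apply/(exposed_mem i vT).
by apply: ST; exact: mem_chull.
Qed.

Lemma exposed_inj v S T : exposed v S -> exposed v T ->
  chull v S = chull v T -> S = T.
Proof.
move=> vS vT ST; apply/eqP; rewrite finset.eqEsubset.
by apply/andP; split; [apply/(exposed_sub S vT)|apply/(exposed_sub T vS)];
  rewrite ST.
Qed.

Lemma exposed0 v : exposed v finset.set0.
Proof.
exists (fun=> -1); split; first exact: affine_cst.
  by move=> i; rewrite lerN10.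
by move=> i; rewrite inE oppr_eq0 oner_eq0.
Qed.

Lemma exposedT v : exposed v finset.setT.
Proof.
exists (fun=> 0); split; [exact: affine_cst|by []|].
by move=> i; rewrite inE eqxx.
Qed.

(** An index of nonzero weight in a convex representation of [z] also attains the maximum of the
    supporting functional, so its point lies in the face [[set z]]. *)
Lemma face_chull1 v S z : face (chull v S) [set z] -> exists2 i,
  i \in S & z = v i.
Proof.
move=> [u [c [uc]]] /seteqP[/(_ z erefl) [/chullP[d [d0 dS d1 zE]] uz] Fz].
have [i di] : exists i, d i != 0.
  apply: contrapT => /forallNP d00; have : \sum_i d i = 0.
    by rewrite big1 // => i _; apply/eqP; apply: contrapT => /negP; apply: d00.
  by rewrite d1 => /eqP; rewrite oner_eq0.
have iS : i \in S by apply: contraNT di => /dS ->.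
exists i => //; apply/esym/Fz; split; first exact: mem_chull.
have du j : d j * (c - dot u (v j)) = 0.
  apply: (psumr_eq0P (P := xpredT) (F := fun j => d j * (c - dot u (v j)))) =>
    //.
    move=> k _; have [kS|/dS ->] := boolP (k \in S); last by rewrite mul0r.
    by rewrite mulr_ge0 // subr_ge0 uc //; exact: mem_chull.
  under eq_bigr do rewrite mulrBr.
  by rewrite sumrB -mulr_suml d1 mul1r -dot_sumr -zE uz subrr.
have /eqP := du i; rewrite mulf_eq0 (negbTE di) subr_eq0 => /eqP.
by move=> ->.
Qed.

Lemma face_face (Q F G : set 'rV[R]_n) :
  face Q G -> G `<=` F -> F `<=` Q -> face F G.
Proof.
move=> [u [c [uc GE]]] GF FQ; exists u, c; split; first by move=> z /FQ /uc.
apply/seteqP; split => z.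
  by move=> Gz; split; [exact: GF|move: Gz; rewrite GE => -[]].
by move=> [/FQ Qz uz]; rewrite GE; split.
Qed.

Definition vertex_enum v (Q : set 'rV[R]_n) : Prop :=
  [/\ injective v, Q = chull v finset.setT & forall i, vertices Q (v i)].

Lemma chull1 v i : chull v [set i]%SET = [set v i].
Proof.
rewrite -[RHS]hull1; congr hull; apply/seteqP; split => z.
  by move=> [j /=]; rewrite inE => /eqP -> <-.
by move=> ->; exists i; rewrite //= inE.
Qed.

Lemma vertices_chull v Q S : vertex_enum v Q -> exposed v S ->
  vertices (chull v S) = v @` [set i | i \in S].
Proof.
move=> vQ vS; apply/seteqP; split=> z; first by move=> /face_chull1[i iS ->];
  exists i.
move=> [i iS <-]; have [_ QE /(_ i)] := vQ; rewrite QE => vi.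
apply: (face_face vi); last exact: (chullS (finset.subsetT S)).
by move=> _ ->; exact: mem_chull.
Qed.

Lemma nvertices_enum v Q : vertex_enum v Q -> nvertices Q = #|I|.
Proof.
move=> vQ; have [vI QE _] := vQ; rewrite /nvertices QE.
rewrite (vertices_chull vQ (exposedT v)).
rewrite (_ : v @` _ = [set` [fset v i | i in I]%fset]); last first.
  apply/seteqP; split => z /=; first by move=> [i _ <-]; exact: in_imfset.
  by move=> /imfsetP[i _ ->]; exists i => //=; rewrite inE.
by rewrite set_fsetK card_imfset //= cardE.
Qed.

End Faces.

(** A generating subfamily of minimal size is taken. No member lies in the hull of the others, so
    each can be strictly separated from them, which makes it a vertex and the enumeration
    injective. *)
Lemma polytope_vertex_enum (R : realType) (n : nat) (Q : set 'rV[R]_n) :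
  polytope Q -> exists (N : nat) (v : 'I_N -> 'rV[R]_n), vertex_enum v Q.
Proof.
move=> [s ->]; pose w (i : 'I_(size s)) := nth 0 s i.
have wE : chull w finset.setT = hull [set` s].
  congr hull; apply/seteqP; split=> z /=.
    by move=> [i _ <-]; exact: mem_nth.
  move=> zs; have iz : (index z s < size s)%N by rewrite index_mem.
  by exists (Ordinal iz); rewrite /w /= ?nth_index // inE.
pose gen (S : {set 'I_(size s)}) := `[< chull w S = hull [set` s] >].
have genT : gen finset.setT by apply/asboolP.
case: (arg_minnP (fun S : {set 'I_(size s)} => #|S|) genT) =>
  S /asboolP SE Smin.
have Sirr i : i \in S -> ~ chull w (S :\ i) (w i).
  move=> iS wi; suff /Smin : gen (S :\ i) by rewrite (cardsD1 i S) iS ltnn.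
  apply/asboolP; rewrite -SE; apply/seteqP; split;
    first exact: (chullS (finset.subD1set S i)).
  apply: hull_subset; first exact: convex_hull.
  move=> _ [j /= jS <-]; have [-> //|ji] := eqVneq j i.
  by apply: mem_chull; rewrite !inE ji.
pose v (l : 'I_#|S|) := w (enum_val l).
have vE : chull v finset.setT = hull [set` s].
  rewrite -SE; congr hull; apply/seteqP; split => z.
    by move=> [l _ <-]; exists (enum_val l) => //; exact: enum_valP.
  by move=> [i /= iS <-]; exists (enum_rank_in iS i);
    rewrite /v ?enum_rankK_in //= inE.
have vsep l : exists2 f, supports v f [set l]%SET & forall j,
  j != l -> f (v j) < 0.
  have lS := enum_valP l; have [f af [f0 fS]] := separation (Sirr _ lS).
  have flt j : j != l -> f (v j) < 0.
    move=> jl; apply: fS; rewrite !inE enum_valP andbT.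
    by rewrite (inj_eq enum_val_inj).
  exists f => //; split => // j; rewrite ?inE; have [->|jl] := eqVneq j l.
  - by rewrite f0.
  - exact/ltW/flt.
  - by rewrite f0 eqxx.
  - by apply/negbTE; rewrite lt_eqF // flt.
exists #|S|, v; split => // [l l' vl|l].
  apply/eqP; apply: contrapT => /negP ll; have [f [_ _ /(_ l')]] := vsep l'.
  by rewrite inE eqxx => /eqP f0 /(_ l ll); rewrite vl f0 ltxx.
have [f vf _] := vsep l; rewrite /vertices /= -vE -chull1.
exact: face_supports vf.
Qed.

(** * Simplicial polytopes *)

(** A large multiple of [g] dominates [h] wherever [g] is negative. Where [g i = 0] the quotient
    [h i / g i] is 0 by convention and does not disturb the bound. *)
Lemma perturbation (R : realType) (I : finType) (g h : I -> R) :
  exists2 N, 0 < N & forall i, g i < 0 -> N * g i + h i < 0.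
Proof.
exists (1 + \sum_i `|h i / g i|); first by rewrite ltr_wpDr // sumr_ge0.
move=> i gi; have gi0 : g i != 0 by rewrite lt_eqF.
have le_sum : `|h i / g i| <= \sum_j `|h j / g j|.
  by rewrite (bigD1 i) //= lerDl sumr_ge0.
apply: (@le_lt_trans _ _ ((1 + `|h i / g i|) * g i + h i)).
  by rewrite lerD2r ler_nM2r // lerD2l.
have E : `|h i / g i| * g i = - `|h i|.
  by rewrite normrM normfV (ltr0_norm gi) invrN mulrN mulNr mulfVK.
rewrite mulrDl mul1r E -addrA addrC.
by rewrite -(addr0 0) ler_ltD // addrC subr_le0 ler_norm.
Qed.

(** The ratio test: [t] is the least [- g i / h i] over the indices with [h i] positive, the moment
    when a strictly negative entry first reaches zero. *)
Lemma first_zero (R : realType) (I : finType) (g h : I -> R) :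
  (forall i, g i <= 0) -> (forall i, g i = 0 -> h i = 0) -> (exists i,
    0 < h i) ->
  exists t, [/\ 0 < t, forall i, g i + t * h i <= 0
              & exists i, g i != 0 /\ g i + t * h i = 0].
Proof.
move=> g0 gh [i0 hi0].
have glt i : 0 < h i -> g i < 0.
  by move=> hi; rewrite lt_neqAle g0 andbT; apply: contraL hi => /eqP/gh ->;
    rewrite ltxx.
case: (@arg_minP _ R _ i0 (fun i => 0 < h i) (fun i => - g i / h i) hi0) =>
  j hj jmin.
exists (- g j / h j); split.
- by rewrite divr_gt0 // oppr_gt0 glt.
- move=> i; have [hi|hi] := ltP 0 (h i).
    by rewrite addrC -lerBrDr sub0r -ler_pdivlMr // jmin.
  rewrite -(addr0 0) lerD // mulr_ge0_le0 // divr_ge0 ?oppr_ge0 // ltW //.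
- exists j; split; first by rewrite lt_eqF // glt.
  by rewrite mulfVK ?subrr // gt_eqF.
Qed.

Lemma set_between (T : finType) (A C : {set T}) k :
  A \subset C -> (#|A| <= k <= #|C|)%N ->
  exists B : {set T}, [/\ A \subset B, B \subset C & #|B| = k].
Proof.
move=> AC /andP[]; elim: k => [|k IH] Ak kC.
  by exists A; split=> //; apply/eqP; rewrite -leqn0.
have [Ak'|Ak'] := eqVneq #|A| k.+1; first by exists A.
have [||B [AB BC Bk]] := IH; [by rewrite -ltnS ltn_neqAle Ak'|exact: ltnW|].
have /fintype.subsetPn[x xC xB] : ~~ (C \subset B).
  by apply/negP => /subset_leq_card; rewrite Bk leqNgt kC.
exists (x |: B); split.
- exact: fintype.subset_trans AB (finset.subsetU1 x B).
- by rewrite finset.subUset finset.sub1set xC.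
- by rewrite cardsU1 xB Bk.
Qed.

Section Simplicial.
Context {R : realType} {n : nat} {I : finType}.
Implicit Types (v : I -> 'rV[R]_n) (f g h : 'rV[R]_n -> R) (S T A : {set I}).

Definition full v : Prop := affdim (chull v finset.setT) = n%:Z.

Lemma full_affine0 v f : full v -> affine f -> (forall i, f (v i) = 0) ->
  forall z, f z = 0.
Proof.
rewrite /full => fv af f0; have [p [ip pQ]] :
    exists p : 'I_n.+1 -> 'rV[R]_n, affindep p /\ forall l,
      chull v finset.setT (p l).
  by apply: affdim_wit; rewrite fv -addn1 PoszD addrK.
apply: (@affine_eq0 _ _ _ p finset.setT) => //.
- by move=> c _; exact: ip.
- by rewrite cardsT card_ord.
- move=> l _; have /chullP[c [_ _ c1 ->]] := pQ l.
  by rewrite affine_comb1 // big1 // => i _; rewrite f0 mulr0.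
Qed.

Definition zeros v g : {set I} := [set i | g (v i) == 0]%SET.

Definition nonpositive v g : Prop :=
  [/\ affine g, forall i, g (v i) <= 0 & exists i, g (v i) != 0].

(** A functional [h] vanishes on the zeros of [g] and on one further vertex [i1]. Turning [g] in the
    directions [h] and [- h] until a new zero appears expresses [g] by two functionals with more
    zeros; at [i1] both keep the value of [g], hence are nontrivial. *)
Lemma rotate v g : full v -> nonpositive v g ->
  (#|zeros v g| < n)%N ->
  exists g1 g2 a b,
    [/\ 0 < a, 0 < b, forall z, g z = a * g1 z + b * g2 z,
       nonpositive v g1 /\
       zeros v g \proper zeros v g1
     & nonpositive v g2 /\
       zeros v g \proper zeros v g2].
Proof.
set Z := zeros v g => fv [ag g0 [i1 gi1]] Zn.
have i1Z : i1 \notin Z by rewrite inE.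
have Z1n : (#|i1 |: Z| <= n)%N by rewrite cardsU1 i1Z.
have [h ah [[z hz] hZ]] := affine_vanishing v Z1n.
have {z hz} [k hk] : exists k, h (v k) != 0.
  apply: contrapT => /forallNP h0; move/eqP: hz; apply.
  by apply: (full_affine0 fv ah) => i; apply/eqP; apply: contrapT => /negP;
    exact: h0.
wlog {hk} hk : h ah hZ / exists k, 0 < h (v k).
  move=> W; have [hk0|hk0|hk0] := ltgtP (h (v k)) 0;
    last by rewrite hk0 eqxx in hk.
    apply: (W (fun z => - h z)); first exact: affineN.
      by move=> i /hZ ->; rewrite oppr0.
    by exists k; rewrite oppr_gt0.
  by apply: (W h) => //; exists k.
have gh i : g (v i) = 0 -> h (v i) = 0.
  by move=> gi; apply: hZ; rewrite !inE gi eqxx orbT.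
have hi1 : h (v i1) = 0 by apply: hZ; rewrite setU11.
have good h' : affine h' -> (forall i, g (v i) = 0 -> h' (v i) = 0) ->
    h' (v i1) = 0 -> (exists k, 0 < h' (v k)) ->
    exists t, [/\ 0 < t, nonpositive v (fun z => g z + t * h' z)
      & Z \proper zeros v (fun z => g z + t * h' z)].
  move=> ah' gh' h'i1 h'pos.
  have [t [t0 tle [j [gj tj]]]] := first_zero g0 gh' h'pos.
  exists t; split => //.
    split => //; first by apply: affineD => //; exact: affineZ.
    by exists i1; rewrite h'i1 mulr0 addr0.
  apply/properP; split; last by exists j; rewrite !inE ?tj.
  apply/fintype.subsetP => i; rewrite !inE => /eqP gi.
  by rewrite gi gh' // mulr0 addr0.
have [t [t0 tN tZ]] := good h ah gh hi1 hk.
have [[k' hk']|hneg] := pselect (exists k, h (v k) < 0).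
  have [||||t' [t'0 t'N t'Z]] := good (fun z => - h z).
  - exact: affineN.
  - by move=> i /gh ->; rewrite oppr0.
  - by rewrite hi1 oppr0.
  - by exists k'; rewrite oppr_gt0.
  (* The weights have sum 1 and cancel the two multiples of [h]. *)
  exists (fun z => g z + t * h z), (fun z => g z + t' * - h z).
  exists (t' / (t + t')), (t / (t + t')); split => //.
  - by rewrite divr_gt0 // addr_gt0.
  - by rewrite divr_gt0 // addr_gt0.
  - by move=> z; field; rewrite gt_eqF // addr_gt0.
(* When [h] takes no negative value at the vertices, [- h] is itself nonpositive and has [i1] as an
   additional zero. *)
exists (fun z => g z + t * h z), (fun z => - h z), 1, t; split => //.
- by move=> z; ring.
- split; first split.
  + exact: affineN.
  + move=> i; rewrite oppr_le0 leNgt; apply/negP => hi.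
    by apply: hneg; exists i.
  + by case: hk => k' hk'; exists k'; rewrite oppr_eq0 gt_eqF.
  apply/properP; split; last by exists i1; rewrite ?inE // hi1 oppr0.
  by apply/fintype.subsetP => i; rewrite !inE => /eqP /gh ->; rewrite oppr0.
Qed.

Definition simplicial v : Prop :=
  full v /\ forall S, exposed v S -> S != finset.setT -> indep v S.

(** With [n + 1] independent points in [S], the supporting functional would vanish identically and
    [S] would be everything. *)
Lemma exposed_card v S :
  simplicial v -> exposed v S -> S != finset.setT -> (#|S| <= n)%N.
Proof.
move=> [fv sv] vS ST; have iS := sv S vS ST.
rewrite leqNgt; apply: contra ST => nS;
  rewrite finset.eqEsubset finset.subsetT /=.
have Sn : #|S| = n.+1 by apply/eqP; rewrite eqn_leq (indep_card iS).
have [f vf] := vS; have [af _ fS] := vf.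
apply/fintype.subsetP => i _; rewrite -fS; apply/eqP.
by apply: (affine_eq0 iS Sn af) => j /(supports_eq0 vf).
Qed.

(** Proper faces are simplices, so some [h] is 0 on [T] and -1 on the rest of [S]; adding a large
    multiple of the functional supporting [S] makes the values outside [S] negative. *)
Lemma exposed_subset v S T :
  simplicial v -> exposed v S -> S != finset.setT -> T \subset S -> exposed v T.
Proof.
move=> [fv sv] vS ST TS; have [g vg] := vS; have [ag g0 gS] := vg.
have [h ah hS] := indep_affine (fun i => - (i \notin T)%:R) (sv S vS ST).
have [N N0 Nlt] := perturbation (g \o v) (h \o v).
have val i : N * g (v i) + h (v i) = - (i \notin T)%:R \/
    (i \notin T /\ N * g (v i) + h (v i) < 0).
  have [iS|iS] := boolP (i \in S).
    by left; rewrite (supports_eq0 vg iS) mulr0 add0r hS.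
  right; split; first by apply: contra iS => /(fintype.subsetP TS).
  by apply: Nlt; exact: (supports_lt0 vg).
exists (fun z => N * g z + h z); split; first by apply: affineD => //;
  exact: affineZ.
  by move=> i; case: (val i) => [->|[_ /ltW//]]; rewrite oppr_le0 ler0n.
move=> i; case: (val i) => [->|[iT lt]];
  first by rewrite oppr_eq0 pnatr_eq0 eqb0 negbK.
by rewrite (negbTE iT) lt_eqF.
Qed.

(* The cone of nonpositive functionals vanishing on S is generated by facet
   functionals; stated as an induction principle. *)
Lemma facet_cone v (N : ('rV[R]_n -> R) -> Prop) g S :
  simplicial v -> supports v g S -> S != finset.setT ->
  (forall f A, supports v f A -> #|A| = n -> S \subset A -> N f) ->
  (forall f1 f2 a b, 0 < a -> 0 < b -> N f1 -> N f2 ->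
     N (fun z => a * f1 z + b * f2 z)) ->
  N g.
Proof.
(* Induction on the number of zeros missing from a facet; [rotate] strictly decreases it. *)
move=> sv vg ST Nf Nadd; move: {2}(n - #|S|)%N (leqnn (n - #|S|)) => k.
elim: k g S vg ST Nf => [|k IH] g S vg ST Nf nS;
  have Sn' := exposed_card sv (ex_intro _ g vg) ST.
  by apply: (Nf g S) => //; lia.
have [Sn|Sn] := ltnP #|S| n; last by apply: (Nf g S) => //; lia.
have SZ : S = zeros v g by apply/setP => i; have [_ _ gS] := vg; rewrite inE gS.
have gN : nonpositive v g.
  have [ag g0 gS] := vg; split => //.
  have [i iS] : exists i, i \notin S.
    apply/existsP; rewrite -negb_forall; apply: contra ST => /forallP SI.
    by apply/eqP/setP => i; rewrite SI inE.
  by exists i; rewrite gS.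
rewrite SZ in Sn; have [g1 [g2 [a [b [a0 b0 gE]]]]] := rotate sv.1 gN Sn.
have step g' : nonpositive v g' ->
    zeros v g \proper zeros v g' -> N g'.
  move=> [ag' g'0 [i g'i]] Zg'; apply: IH (supports_zeros ag' g'0) _ _ _.
  - by apply/eqP => /setP/(_ i); rewrite !inE (negbTE g'i).
  - move=> f A vf An ZA; apply: (Nf f A) => //; rewrite SZ.
    exact: (fintype.subset_trans (proper_sub Zg')).
  - apply: leq_trans (leq_sub2l n (proper_card Zg')) _.
    by rewrite SZ in nS; rewrite subnS; move: nS; case: (n - _)%N.
move=> [g1N g1Z] [g2N g2Z].
rewrite (_ : g = fun z => a * g1 z + b * g2 z); last exact/funext.
by apply: Nadd => //; exact: step.
Qed.

(** If every facet functional through [S] vanished at [v i], so would every functional in the cone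
    they generate, in particular the one exposing [S]. *)
Lemma facet_avoiding v S i : simplicial v -> exposed v S -> i \notin S ->
  exists A, [/\ exposed v A, #|A| = n, S \subset A & i \notin A].
Proof.
move=> sv [g vg] iS; have ST : S != finset.setT by apply: contraNneq iS => ->;
  rewrite inE.
apply: contrapT => /forallNP H.
suff g0 : g (v i) = 0 by have [_ _ gS] := vg; move: iS; rewrite -gS g0 eqxx.
apply: (@facet_cone v (fun f => f (v i) = 0) g S) => //.
  move=> f A vf An SA; apply/eqP; have [_ _ ->] := vf;
    apply: contrapT => /negP iA.
  by apply: (H A); split => //; exists f.
by move=> f1 f2 a b _ _ -> ->; rewrite !mulr0 addr0.
Qed.

Lemma facet_neqT v A : full v -> exposed v A -> #|A| = n -> A != finset.setT.
Proof.
move=> fv _ An; apply/eqP => AT.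
have [f af [[z fz] fA]] := affine_vanishing v (eq_leq An).
by move/eqP: fz; apply; apply: (full_affine0 fv af) => i; rewrite fA // AT inE.
Qed.

Lemma exposed_subset_facet v A S : simplicial v -> exposed v A -> #|A| = n ->
  S \subset A -> exposed v S.
Proof.
by move=> sv vA An; apply: exposed_subset => //; apply: facet_neqT vA An;
  case: sv.
Qed.

Definition general_position v : Prop := forall S, (#|S| <= n.+1)%N -> indep v S.

(** An exposed set with more than [n] indices contains an affine basis, which forces its supporting
    functional to be zero. *)
Lemma general_position_simplicial v :
  full v -> general_position v -> simplicial v.
Proof.
move=> fv gv; split=> // S vS ST; apply: (gv S); rewrite leqNgt;
  apply: contra ST => nS.
have [A AS An] : exists2 A : {set I}, A \subset S & #|A| = n.+1.
  have [||A [_ AS An]] := @set_between I finset.set0 S n.+1; last by exists A.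
    exact: finset.sub0set.
  by rewrite cards0 (ltnW nS).
have [f vf] := vS; have [af _ fS] := vf.
have f0 := affine_eq0 (gv A (eq_leq An)) An af.
rewrite finset.eqEsubset finset.subsetT /=; apply/fintype.subsetP => i _.
by rewrite -fS f0 // => j /(fintype.subsetP AS) /(supports_eq0 vf).
Qed.

(* Radon: one of the two sides of the dependence, say the positive one, has at
   most d elements outside K; a face containing K and this side but missing an
   element of the other one contradicts the dependence. *)
Lemma radon v (K D : {set I}) d (c : I -> R) :
  (forall T, #|T| = d -> T \subset ~: K -> exposed v (K :|: T)) ->
  (d < #|~: K|)%N ->
  \sum_i c i = 0 -> \sum_i c i *: v i = 0 ->
  supported (K :|: D) c -> (#|D| <= d.*2.+1)%N ->
  forall i, i \notin K -> c i = 0.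
Proof.
move=> vK dK; pose pos (c : I -> R) := [set i in ~: K | 0 < c i]%SET.
have half e : \sum_i e i = 0 -> \sum_i e i *: v i = 0 ->
    (#|pos e| <= d)%N -> forall i, i \notin K -> 0 <= e i.
  move=> e0 ev ed i iK; rewrite leNgt; apply/negP => ei.
  (* The positive indices are padded to exactly [d] elements while [i] is left out; there is room
     because the complement of [K] has more than [d] elements. *)
  have [T [posT iT Td KT]] : exists T : {set I}, [/\ pos e \subset T,
    i \notin T,
      #|T| = d & T \subset ~: K].
    have iD : i \notin pos e by rewrite !inE iK -leNgt ltW.
    have sub : pos e \subset ~: K :\ i.
      apply/fintype.subsetP => j jp; rewrite !inE; move: (jp); rewrite !inE.
      by move=> /andP[-> _]; rewrite andbT; apply: contraNneq iD => <-.
    have [|T [pT TK Td]] := @set_between I (pos e) (~: K :\ i) d sub.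
      by rewrite ed /=; move: dK; rewrite (cardsD1 i (~: K)) inE iK.
    exists T; split => //.
      by apply/negP => /(fintype.subsetP TK); rewrite !inE eqxx.
    exact: fintype.subset_trans TK (finset.subD1set _ _).
  have [f vf] := vK T Td KT; have [af _ _] := vf.
  have ef j : 0 <= e j * f (v j).
    have [jT|jT] := boolP (j \in K :|: T);
      first by rewrite (supports_eq0 vf jT) mulr0.
    rewrite mulr_le0 ?(ltW (supports_lt0 vf jT)) // leNgt;
      apply: contra jT => ej.
    rewrite inE; have [//|jK] := boolP (j \in K).
    by rewrite (fintype.subsetP posT) // !inE jK.
  have := psumr_eq0P (fun j _ => ef j) (affine_comb0 af e0 ev) (i := i) isT.
  have : f (v i) < 0 by apply: (supports_lt0 vf);
    rewrite inE (negbTE iK) (negbTE iT).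
  by move=> fi /eqP; rewrite mulf_eq0 !lt_eqF.
move=> c0 cv cKD Dd.
(* Once [e] is nonnegative outside [K], the negated dependence has no positive index there, and
   [half] applies to it as well. *)
have oneside e : \sum_i e i = 0 -> \sum_i e i *: v i = 0 -> (#|pos e| <= d)%N ->
    forall i, i \notin K -> e i = 0.
  move=> e0 ev ed i iK; apply/le_anti; rewrite (half e) // andbT -oppr_ge0.
  apply: (half (fun i => - e i)) => //.
  - by rewrite sumrN e0 oppr0.
  - by under eq_bigr do rewrite scaleNr; rewrite sumrN ev oppr0.
  - rewrite (_ : pos _ = finset.set0) ?cards0 //; apply/setP => j.
    rewrite !inE; apply/negP => /andP[jK]; rewrite oppr_gt0 ltNge.
    by rewrite (half e).
have [pc|pc] := leqP #|pos c| d; first exact: oneside.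
move=> i iK; apply: oppr_inj; rewrite oppr0.
apply: (oneside (fun i => - c i)) => //.
- by rewrite sumrN c0 oppr0.
- by under eq_bigr do rewrite scaleNr; rewrite sumrN cv oppr0.
(* The two sides are disjoint subsets of [D], which has at most [2 d + 1] elements, so they cannot
   both exceed [d]. *)
have : pos c :&: pos (fun i => - c i) = finset.set0.
  apply/setP => j; rewrite !inE oppr_gt0;
    apply/negP => /andP[/andP[_ j1] /andP[_ j2]].
  by have := lt_trans j1 j2; rewrite ltxx.
move=> disj; have := cardsUI (pos c) (pos (fun i => - c i)).
rewrite disj cards0 addn0.
have /subset_leq_card : pos c :|: pos (fun i => - c i) \subset D.
  apply/fintype.subsetP => j; rewrite !inE oppr_gt0 -andb_orr => /andP[jK cj].
  apply: contraTT cj => jD; rewrite cKD ?ltxx // finset.in_setU (negbTE jK).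
  exact: jD.
by move: Dd pc; rewrite -addnn; lia.
Qed.

End Simplicial.

(** * Quotient polytopes and universal faces *)

Lemma image_set_inj (T : choiceType) (I : finType) (v : I -> T) (S S' : {set
  I}) :
  injective v -> v @` [set i | i \in S] = v @` [set i | i \in S'] -> S = S'.
Proof.
move=> vI /seteqP[SS' S'S]; apply/setP => i; apply/idP/idP => iS.
  by have [|j jS' /vI <-] := SS' (v i); first by exists i.
by have [|j jS /vI <-] := S'S (v i); first by exists i.
Qed.

Lemma polytope_chull (R : realType) (n : nat) (I : finType) (v : I -> 'rV[R]_n)
  (S : {set I}) : polytope (chull v S).
Proof.
exists [seq v i | i <- enum S]; congr hull; apply/seteqP; split => z /=.
  by move=> [i iS <-]; apply/mapP; exists i; rewrite ?mem_enum.
by move=> /mapP[i]; rewrite mem_enum => iS ->; exists i.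
Qed.

Section NeighbourlyEnum.
Context {R : realType} {n : nat} {I : finType}.
Variables (v : I -> 'rV[R]_n) (Q : set 'rV[R]_n).
Hypothesis vQ : vertex_enum v Q.

Lemma face_enum (F : set 'rV[R]_n) :
  face Q F <-> exists2 S, exposed v S & F = chull v S.
Proof.
have [_ -> _] := vQ; split; first exact: face_exposed.
by move=> [S vS ->]; exact: exposed_face.
Qed.

Lemma neighbourly_exposed d : neighbourly d Q ->
  forall T : {set I}, #|T| = d./2 -> exposed v T.
Proof.
move=> [_ _ nQ] T Td; have [vI _ vV] := vQ.
pose s := [fset v i | i in T]%fset.
have sE : [set` s] = v @` [set i | i \in T].
  apply/seteqP; split => z /=; first by move=> /imfsetP[i /= iT ->]; exists i.
  by move=> [i iT <-]; exact: in_imfset.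
have [||F [/face_enum[T' vT' FE] _] FV] := nQ s.
- by rewrite sE => _ [i _ <-].
- by rewrite card_imfset //= -cardE.
suff -> : T = T' by [].
by apply: (image_set_inj vI); rewrite -sE -FV FE (vertices_chull vQ).
Qed.

Lemma exposed_neighbourly d : affdim Q = d%:Z -> (d./2 < #|I|)%N ->
  (forall T : {set I}, #|T| = d./2 -> exposed v T) -> neighbourly d Q.
Proof.
have [vI QE vV] := vQ => dQ dI vT; split => //.
  by rewrite QE; exact: polytope_chull.
move=> s sV sd; pose T := [set i | v i \in s]%SET.
have sE : [set` s] = v @` [set i | i \in T].
  apply/seteqP; split => z /=; last by move=> [i]; rewrite inE => vs <-.
  move=> zs; have := sV z zs; rewrite {1}QE (vertices_chull vQ (exposedT v)).
  by move=> [i _ iz]; exists i => //; rewrite /= inE iz.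
have Td : #|T| = d./2.
  rewrite -sd; have -> : s = [fset v i | i in T]%fset.
    apply/fsetP => z; apply/idP/imfsetP => /= [zs|[i]].
      have : [set` s] z by []. 
      by rewrite sE => -[i iT <-]; exists i.
    by rewrite inE => vs ->.
  by rewrite card_imfset //= -cardE.
exists (chull v T); last by rewrite (vertices_chull vQ) ?sE //; exact: vT.
split; first by apply/face_enum; exists T => //; exact: vT.
rewrite QE => /(exposed_inj (vT T Td) (exposedT v)) TT.
by move: dI; rewrite -Td TT cardsT ltnn.
Qed.

End NeighbourlyEnum.

Definition universal_set (R : realType) (n : nat) (I : finType)
    (v : I -> 'rV[R]_n) (S : {set I}) (d : nat) : Prop :=
  forall T : {set I}, #|T| = d -> T \subset ~: S -> exposed v (S :|: T).

Section UniversalExposed.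
Context {R : realType} {m : nat} {I : finType}.
Variables (v : I -> 'rV[R]_(2 * m)) (Q : set 'rV[R]_(2 * m)).
Hypotheses (vQ : vertex_enum v Q) (sv : simplicial v).

Lemma affdim_enum : affdim Q = (2 * m)%:Z.
Proof. by have [_ -> _] := vQ; case: sv. Qed.

(** The lattice isomorphism carries vertices of [L] to atoms of the interval above [S], and in a
    simplicial polytope these are the sets [i |: S]. The vertex count makes this correspondence a
    bijection with the complement of [S], along which neighbourliness is transported. *)
Lemma universal_universal_set (S : {set I}) k :
  (0 < k <= m)%N -> exposed v S -> #|S| = (2 * k)%N ->
  universal (2 * k - 1) Q (chull v S) -> universal_set v S (m - k).
Proof.
move=> /andP[k0 km] vS Sk [FU dU UL].
have [kE|km'] := eqVneq k m.
  move=> T; rewrite kE subnn => /eqP; rewrite cards_eq0 => /eqP -> _.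
  by rewrite finset.setU0.
case: UL => [[_]|[e [d [L [[pL dL [f [[fF fI fS] fle]]] nL vL]]]]].
  by rewrite dU affdim_enum; lia.
have [N [w wL]] := polytope_vertex_enum pL.
have [wI LE wV] := wL; have [vI QE vV] := vQ.
have cardI : (N + 2 * k)%N = #|I|.
  by move: vL; rewrite (nvertices_enum wL) (nvertices_enum vQ) card_ord; lia.
have dE : d./2 = (m - k)%N.
  have [_ dL' _] := nL; move: dL; rewrite dL' affdim_enum dU => ?.
  have -> : d = (m - k).*2 by lia.
  by rewrite doubleK.
have ST : S != finset.setT.
  apply/eqP => ST; have := dU; rewrite ST -QE affdim_enum; lia.
have f_face G : face L G -> exists2 S',
  exposed v S' & f G = chull v S' /\ S \subset S'.
  move=> LG; have [/(face_enum vQ)[S' vS' fE] UG] := fF G LG.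
  by exists S' => //; split => //; apply/(exposed_sub S vS'); rewrite -fE.
have f_sur S' : exposed v S' -> S \subset S' -> exists2 G,
  face L G & f G = chull v S'.
  move=> vS' SS'; have [|G LG fG] := fS (chull v S').
    split; first by apply/(face_enum vQ); exists S'.
    by apply/exposed_sub.
  by exists G.
have L0 : face L classical_sets.set0.
  by apply/(face_enum wL); exists finset.set0; [exact: exposed0|
    rewrite -hull0; congr hull; apply/seteqP; split => z // [i /=];
      rewrite inE].
have f0 : f classical_sets.set0 = chull v S.
  have [G LG fG] := f_sur S vS (fintype.subxx S).
  apply/seteqP; split; first by rewrite -fG; apply/fle => // z.
  by have [] := fF _ L0.
(* A point has only two faces, itself and the empty one, and the empty one corresponds to [S]. *)
have atom S' j : exposed v S' -> S \proper S' -> chull v S' `<=` f [set w j] ->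
    f [set w j] = chull v S'.
  move=> vS' SS' sub; have [G LG fG] := f_sur S' vS' (proper_sub SS').
  rewrite -fG; congr f; apply/seteqP; split; last by apply/fle; rewrite ?fG //;
    exact: wV.
  suff [z Gz] : exists z, G z.
    have : G `<=` [set w j] by apply/fle; rewrite ?fG //; exact: wV.
    by move=> Gw _ ->; rewrite -(Gw z Gz).
  apply: contrapT => /forallNP G0.
  have GE : G = classical_sets.set0 by apply/seteqP; split => z //; move/G0.
  move: fG; rewrite GE f0 => /(exposed_inj vS vS') SE.
  by move: SS'; rewrite SE fintype.properxx.
(* A facet above [S] and an index [i0] of it outside [S] give a proper face strictly above [S]; this
   prevents an atom from being the whole polytope. *)
have [A [vA An SA]] : exists A, [/\ exposed v A,
  #|A| = (2 * m)%N & S \subset A].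
  have [i iS] : exists i, i \notin S.
    apply/existsP; rewrite -negb_forall; apply: contra ST => /forallP SI.
    by apply/eqP/setP => i; rewrite SI inE.
  by have [A [vA An SA _]] := facet_avoiding sv vS iS; exists A.
have AT : A != finset.setT by apply: facet_neqT vA An; case: sv.
have [i0 i0A i0S] : exists2 i, i \in A & i \notin S.
  by apply/fintype.subsetPn; apply/negP => /subset_leq_card; rewrite An Sk; lia.
have i0exp : exposed v (i0 |: S).
  by apply: exposed_subset sv vA AT _;
    rewrite finset.subUset finset.sub1set i0A.
have properU1 i : i \notin S -> S \proper i |: S.
  by move=> iS; rewrite properE finset.subsetU1 finset.subUset finset.sub1set
    (negbTE iS).
have phi_ex j : exists i, [/\ i \notin S, exposed v (i |: S)
    & f [set w j] = chull v (i |: S)].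
  have [S' vS' [fS' SS']] := f_face _ (wV j).
  have S'T : S' != finset.setT.
    apply/eqP => S'T; have := atom (i0 |: S) j i0exp (properU1 _ i0S).
    rewrite fS' S'T => /(_ (chullS (finset.subsetT _))) /(exposed_inj (exposedT
      v) i0exp).
    move/eqP; rewrite eq_sym; apply/negP; apply: contra AT => /eqP E.
    rewrite finset.eqEsubset finset.subsetT -E finset.subUset finset.sub1set
      i0A.
    exact: SA.
  have [i iS' iS] : exists2 i, i \in S' & i \notin S.
    apply/fintype.subsetPn; apply/negP => S'S.
    have SE : S' = S by apply/eqP; rewrite finset.eqEsubset S'S.
    have : w j \in [set w j] by apply/mem_set.
    suff -> : [set w j] = classical_sets.set0 by move/set_mem.
    apply/seteqP; split => //; apply/fle => //; first exact: wV.
    by rewrite f0 fS' SE.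
  have iSS' : i |: S \subset S' by rewrite finset.subUset finset.sub1set iS'.
  have vi : exposed v (i |: S) by apply: exposed_subset sv vS' S'T iSS'.
  exists i; split => //; apply: atom => //; first exact: properU1.
  by rewrite fS'; exact: chullS.
have [phi phiP] := choice phi_ex.
have phiI : injective phi.
  move=> j j' jj'; apply: wI.
  have fj : f [set w j] = f [set w j'].
    by have [_ _ ->] := phiP j; have [_ _ ->] := phiP j'; rewrite jj'.
  have : [set w j] `<=` [set w j'] by apply/fle; rewrite ?fj //; exact: wV.
  by move=> /(_ (w j) erefl).
(* An injection between sets of equal size: this is where the exact vertex count in the definition
   of universality enters. *)
have phiS : [set phi j | j in 'I_N]%SET = ~: S.
  apply/eqP; rewrite eqEcard; apply/andP; split.
    by apply/fintype.subsetP => _ /imsetP[j _ ->]; rewrite inE; case: (phiP j).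
  by rewrite card_imset // card_ord -(leq_add2l #|S|) cardsC Sk -cardI addnC.
move=> T Tk TS; pose T' := [set j | phi j \in T]%SET.
have T'T : [set phi j | j in T']%SET = T.
  apply/setP => i; apply/imsetP/idP => [[j]|iT]; first by rewrite inE => ? ->.
  have : i \in [set phi j | j in 'I_N]%SET by rewrite phiS (fintype.subsetP TS).
  by move=> /imsetP[j _ iE]; exists j; rewrite ?inE -?iE.
have wT' : exposed w T'.
  by apply: (neighbourly_exposed wL nL); rewrite dE -Tk -T'T card_imset.
have LT' : face L (chull w T') by apply/(face_enum wL); exists T'.
have [S'' vS'' [fS'' SS'']] := f_face _ LT'.
(* Both sets contain [S]; outside [S], membership of [phi j] says that the atom of [j] lies below
   the face, which is compared in [L]. *)
suff -> : S :|: T = S'' by [].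
apply/setP => i; rewrite inE; have [iS|iS] := boolP (i \in S).
  by rewrite (fintype.subsetP SS'').
have : i \in [set phi j | j in 'I_N]%SET by rewrite phiS inE.
move=> /imsetP[j _ ->]; have [jS vj fj] := phiP j; rewrite /=.
have -> : (phi j \in T) = (j \in T') by rewrite inE.
have -> : (phi j \in S'') = (phi j |: S \subset S'').
  by rewrite finset.subUset finset.sub1set SS'' andbT.
apply/idP/idP => [jT'|jS''].
  apply/(exposed_sub _ vS''); rewrite -fj -fS''; apply/fle => //;
    first exact: wV.
  by move=> _ ->; exact: mem_chull.
apply/(exposed_mem j wT'); have : [set w j] `<=` chull w T'; last exact.
apply/fle => //; first exact: wV.
by rewrite fj fS''; exact: chullS.
Qed.

End UniversalExposed.

(** * Realising the quotient by a projective map *)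

Section Quotient.
Context {R : realType} {m : nat} {I : finType}.
Variables (v : I -> 'rV[R]_(2 * m)) (Q : set 'rV[R]_(2 * m)).
Hypotheses (vQ : vertex_enum v Q) (sv : simplicial v).

Lemma exposed_neqT (S : {set I}) : (#|S| <= 2 * m)%N -> S != finset.setT.
Proof.
move=> Sm; apply/eqP => ST; have [fv _] := sv.
have [f af [[z /eqP fz] f0]] := affine_vanishing v Sm.
by apply: fz; apply: (full_affine0 fv af) => i; apply: f0; rewrite ST inE.
Qed.

(* The barycentric coordinates, with respect to the vertices of a facet
   containing S and an apex, of the vertices outside S. *)
Lemma barycentric_coordinates (S : {set I}) : exposed v S -> (#|S| <= 2 * m)%N
  ->
  exists (e : nat) (b : 'I_e -> I) (h : 'I_e -> 'rV[R]_(2 * m) -> R),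
    [/\ (e + #|S| = (2 * m).+1)%N, forall l, b l \notin S,
        forall l, affine (h l) /\ (forall i, i \in S -> h l (v i) = 0),
        forall l l', h l (v (b l')) = (l == l')%:R
      & forall H, affine H -> (forall i, i \in S -> H (v i) = 0) ->
        forall z, H z = \sum_l H (v (b l)) * h l z].
Proof.
move=> vS Sm; have [fv iv] := sv.
have [i iS] : exists i, i \notin S.
  apply/existsP; rewrite -negb_forall.
  apply: contra (exposed_neqT Sm) => /forallP SI.
  by apply/eqP/setP => i; rewrite SI inE.
have [A [vA An SA iA]] := facet_avoiding sv vS iS.
pose E := i |: A.
have En : #|E| = (2 * m).+1 by rewrite cardsU1 iA An.
have iE : indep v E.
  have [f vf] := vA; have [af _ fA] := vf.
  apply: (indepU1 _ af (fun j => supports_eq0 vf (i := j))); last by rewrite fA.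
  by apply: iv => //; apply: exposed_neqT; rewrite An.
have SE : S \subset E := fintype.subset_trans SA (finset.subsetU1 i A).
pose b (l : 'I_#|E :\: S|) : I := enum_val l.
have bE l : b l \in E by have := enum_valP l; rewrite inE => /andP[].
have bS l : b l \notin S by have := enum_valP l; rewrite inE => /andP[].
have /choice[h hP] l : exists h, affine h /\
    forall j, j \in E -> h (v j) = (j == b l)%:R.
  by have [h ah hE] := indep_affine (fun j => (j == b l)%:R) iE; exists h.
have hS l j : j \in S -> h l (v j) = 0.
  move=> jS; have [_ ->] := hP l; last exact: (fintype.subsetP SE).
  by case: eqVneq => // jb; move: (bS l); rewrite -jb jS.
have hb l l' : h l (v (b l')) = (l == l')%:R.
  by have [_ ->] := hP l; rewrite // /b (inj_eq enum_val_inj) eq_sym.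
exists #|E :\: S|, b, h; split => //.
- by rewrite -En -(cardsID S E) (finset.setIidPr SE) addnC.
- by move=> l; split; [case: (hP l)|exact: hS].
- move=> H aH HS z; apply/eqP; rewrite -subr_eq0; apply/eqP; move: z.
  have aD : affine (fun z => H z - \sum_l H (v (b l)) * h l z).
    by apply: affineD => //; apply: affineN; apply: affine_sum => l;
      case: (hP l).
  apply: (affine_eq0 iE En aD) => j jE.
  have [jS|jS] := boolP (j \in S).
    by rewrite HS // big1 ?subrr // => l _; rewrite hS // mulr0.
  have jES : j \in E :\: S by rewrite inE jS.
  have -> : j = b (enum_rank_in jES j) by rewrite /b enum_rankK_in.
  rewrite (bigD1 (enum_rank_in jES j)) //= hb eqxx mulr1 big1 ?addr0 ?subrr //.
  by move=> l /negbTE ljn; rewrite hb ljn mulr0.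
Qed.

Variables (S : {set I}) (k : nat).
Hypotheses (k0 : (0 < k)%N) (km : (k < m)%N) (vS : exposed v S).
Hypotheses (Sk : #|S| = (2 * k)%N) (univ : universal_set v S (m - k)).

(** Enlarging [i] to a set of [m - k] indices outside [S] gives a proper face, of which [i |: S] is
    a subface. *)
Lemma universal_set_adjacent i : i \notin S -> exposed v (i |: S).
Proof.
move=> iS; have sub : [set i]%SET \subset ~: S.
  by rewrite finset.sub1set inE.
have cI : (2 * m < #|I|)%N.
  rewrite -cardsT ltnNge; apply/negP => /exposed_neqT.
  by rewrite eqxx.
have [|T [iT TS Tk]] := set_between (k := (m - k)%N) sub.
  by rewrite cards1; have := cardsC S; rewrite Sk; lia.
have ST : S :|: T != finset.setT.
  apply: exposed_neqT; rewrite cardsU Tk Sk; lia.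
apply: (exposed_subset sv (univ Tk TS) ST).
by rewrite finset.setUC finset.setUS.
Qed.

(** The quotient is the hull of the images, under the coordinates [h] divided by [- g], of the
    vertices outside [S]. It has dimension [2 m - 2 k] but lives in one dimension more, inside a
    hyperplane. *)
Lemma universal_set_universal : universal (2 * k - 1) Q (chull v S).
Proof.
have [vI QE vV] := vQ; have [fv iv] := sv.
have Sm : (#|S| <= 2 * m)%N by rewrite Sk; lia.
have dS : affdim (chull v S) = (2 * k - 1)%N%:Z.
  by rewrite affdim_chull ?Sk; [lia|apply: iv => //; exact: exposed_neqT].
split => //; first by apply/(face_enum vQ); exists S.
right; have [e [b [h [eS bS hP hb hH]]]] := barycentric_coordinates vS Sm.
have ek : e = (2 * m - 2 * k).+1 by lia.
have [g vg] := vS; have [ag g0 gS] := vg.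
have glt i : i \notin S -> g (v i) < 0 by exact: supports_lt0 vg.
pose rho z : 'rV[R]_e := \row_l ((- g z)^-1 * h l z).
pose q (j : 'I_#|~: S|) := rho (v (enum_val j)).
pose lift (T : {set 'I_#|~: S|}) := S :|: [set enum_val j | j in T]%SET.
have enumS (j : 'I_#|~: S|) : enum_val j \notin S.
  by have := enum_valP j; rewrite inE.
have enumP i : i \notin S -> exists j : 'I_#|~: S|, i = enum_val j.
  move=> iS; have iC : i \in ~: S by rewrite inE.
  by exists (enum_rank_in iC i); rewrite enum_rankK_in.
have mem_lift j T : (enum_val j \in lift T) = (j \in T).
  rewrite inE (negbTE (enumS j)) /=; apply/imsetP/idP => [[j' jT]|jT].
    by move/enum_val_inj => ->.
  by exists j.
have lift_sub T T' : (lift T \subset lift T') = (T \subset T').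
  apply/idP/idP => [TT'|TT'].
    apply/fintype.subsetP => j jT; rewrite -mem_lift (fintype.subsetP TT') //.
    by rewrite mem_lift.
  by rewrite finset.setUS // imsetS.
(* rho is a projection from the face S composed with a section of the cone:
   affine functionals vanishing on S are those on the image, rescaled by - g. *)
have transfer H l : affine H -> affine l ->
    (forall i, i \in S -> H (v i) = 0) ->
    (forall j, H (v (enum_val j)) = - g (v (enum_val j)) * l (q j)) ->
    forall T, supports q l T <-> supports v H (lift T).
  move=> aH al HS Hl T.
  have gpos (j : 'I_#|~: S|) : 0 < - g (v (enum_val j)).
    by rewrite oppr_gt0 glt ?enumS.
  split=> -[_ l0 lT]; split=> //.
  - move=> i; have [/HS -> //|/enumP[j ->]] := boolP (i \in S).
    by rewrite Hl pmulr_rle0.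
  - move=> i; have [iS|/enumP[j ->]] := boolP (i \in S).
      by rewrite HS // eqxx inE iS.
    by rewrite Hl mulf_eq0 gt_eqF //= lT mem_lift.
  - by move=> j; have := l0 (enum_val j); rewrite Hl (pmulr_rle0 _ (gpos j)).
  - move=> j; have := lT (enum_val j).
    by rewrite Hl mulf_eq0 (gt_eqF (gpos j)) mem_lift.
have exposed_lift T : exposed q T <-> exposed v (lift T).
  split=> [[l ql]|[H vH]].
    have [[u [c lE]] _ _] := ql.
    (* Multiplying [dot u (rho z) - c] by [- g z] clears the denominator and turns the constant into
       a multiple of [g]. *)
    pose H z := (\sum_i u 0 i * h i z) + c * g z.
    exists H; apply/(@transfer H l) => //; try by case: ql.
    - by apply: affineD; [apply: affine_sum => i; case: (hP i)|exact: affineZ].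
    - move=> i iS; rewrite /H (supports_eq0 vg iS) mulr0 addr0 big1 // => i' _.
      by have [_ ->] := hP i'; rewrite ?mulr0.
    - move=> j; rewrite lE mulrBr mulNr /H -/(q j) mulNr opprK [c * _]mulrC.
      congr (_ + _); rewrite -mulNr mulr_sumr; apply: eq_bigr => i _.
      rewrite mxE mulrCA; congr (_ * _).
      by rewrite mulVKf // oppr_eq0 lt_eqF // glt ?enumS.
  have [aH _ _] := vH.
  have HS i : i \in S -> H (v i) = 0.
    by move=> iS; apply: (supports_eq0 vH); rewrite inE iS.
  pose l (y : 'rV[R]_e) := dot (\row_i H (v (b i))) y.
  exists l; apply/(@transfer H l) => //.
    by exists (\row_i H (v (b i))), 0 => y; rewrite subr0.
  move=> j; rewrite (hH H aH HS) /l /dot mulr_sumr; apply: eq_bigr => i _.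
  rewrite !mxE mulrCA; congr (_ * _).
  by rewrite mulVKf // oppr_eq0 lt_eqF // glt ?enumS.
pose L := chull q finset.setT.
have q1 j : exposed q [set j]%SET.
  apply/exposed_lift; rewrite /lift finset.imset_set1 finset.setUC.
  exact: universal_set_adjacent.
have qI : injective q.
  move=> j j' jj'; have : chull q [set j]%SET (q j').
    by rewrite -jj'; apply: mem_chull; rewrite inE.
  by move/(exposed_mem j' (q1 j)); rewrite inE => /eqP ->.
have qL : vertex_enum q L.
  split=> // j; rewrite /vertices /= -chull1; exact: exposed_face.
(* The points [p l] are nonzero multiples of the unit vectors, hence independent, and expanding [g]
   in the coordinates [h] shows that every image satisfies the equation of the hyperplane they
   span. *)
have dL : affdim L = (2 * m - 2 * k)%N%:Z.
  pose p l := rho (v (b l)).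
  have pE l : p l = (- g (v (b l)))^-1 *: delta_mx 0 l.
    by apply/rowP => l'; rewrite !mxE hb eqxx /= [l' == l]eq_sym.
  have gb l : - g (v (b l)) != 0 by rewrite oppr_eq0 lt_eqF // glt ?bS.
  have sumE (c : 'I_e -> R) : \sum_l c l *: p l = \row_l (c l * (- g (v (b
    l)))^-1).
    apply/rowP => l; rewrite summxE (bigD1 l) //= pE !mxE !eqxx mulr1 big1
      ?addr0 //.
    by move=> l' /negbTE ll'; rewrite pE !mxE eq_sym ll' andbF !mulr0.
  rewrite (@affdim_indep _ _ _ p finset.setT).
  - by rewrite cardsT card_ord ek; lia.
  - move=> c _ _; rewrite sumE => /rowP c0 l.
    have /eqP := c0 l; rewrite !mxE mulf_eq0 invr_eq0 (negbTE (gb l)) orbF.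
    by move/eqP.
  - move=> l _; have [j bj] := enumP _ (bS l).
    by rewrite /p bj; apply: (@mem_chull _ _ _ q finset.setT j); rewrite inE.
  - move=> z zL; exists (fun l => z 0 l * - g (v (b l))); split.
    + by move=> l; rewrite inE.
    + pose l0 (y : 'rV[R]_e) := \sum_l y 0 l * - g (v (b l)) - 1.
      have al0 : affine l0.
        exists (\row_l - g (v (b l))), 1 => y; congr (_ - _).
        by apply: eq_bigr => l _; rewrite mxE mulrC.
      have lq j : l0 (q j) = 0.
        have gj : g (v (enum_val j)) != 0 by rewrite lt_eqF // glt ?enumS.
        apply/eqP; rewrite subr_eq0; apply/eqP.
        transitivity ((g (v (enum_val j)))^-1 * g (v (enum_val j)));
          last by rewrite mulVf.
        rewrite [X in _ * X](hH g ag (fun i => supports_eq0 vg (i :=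
          i))) mulr_sumr.
        apply: eq_bigr => l _; rewrite mxE mulrN -mulNr -mulNr -invrN opprK.
        by rewrite mulrAC -mulrA.
      suff : l0 z = 0 by move/subr0_eq.
      move: zL => /chullP[c [_ _ c1 ->]];
        rewrite affine_comb1 // big1 // => j _.
      by rewrite lq mulr0.
    + rewrite sumE; apply/rowP => l; rewrite mxE.
      by rewrite mulfK.
have cI : (2 * m < #|I|)%N.
  by rewrite -cardsT ltnNge; apply/negP => /exposed_neqT; rewrite eqxx.
have cS := cardsC S.
exists e, (2 * m - 2 * k)%N, L; split.
- split; first exact: polytope_chull.
    by rewrite dL dS (affdim_enum vQ sv); lia.
  (* The index set of a face of [L]; adding [S] to it gives the corresponding face of [Q]. *)
  pose idx (G : set 'rV[R]_e) := [set j | `[< G (q j) >]]%SET.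
  have idxE T : exposed q T -> idx (chull q T) = T.
    by move=> qT; apply/setP => j; rewrite inE;
      apply/asboolP/idP => /(exposed_mem j qT).
  exists (fun G => chull v (lift (idx G))); split; last first.
    move=> _ _ /(face_enum qL)[T qT ->] /(face_enum qL)[T' qT' ->].
    rewrite !idxE //; apply: (iff_trans (exposed_sub T qT')).
    rewrite -lift_sub; apply: iff_sym; apply: exposed_sub.
    exact/exposed_lift.
  split.
  + move=> _ /(face_enum qL)[T qT ->]; rewrite /= idxE //.
    move/exposed_lift : qT => vT; split; first by apply/(face_enum vQ);
      exists (lift T).
    by apply: chullS; exact: finset.subsetUl.
  + move=> _ _ /set_mem/(face_enum qL)[T qT ->]
    /set_mem/(face_enum qL)[T' qT' ->].
    rewrite !idxE // => TT; congr chull.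
    have /eqP : lift T = lift T'.
      by apply: exposed_inj TT; apply/exposed_lift.
    by rewrite finset.eqEsubset !lift_sub -finset.eqEsubset => /eqP.
  + move=> _ [/(face_enum vQ)[S' vS' ->] SS'] /=.
    pose T := [set j : 'I_#|~: S| | enum_val j \in S']%SET.
    have TS' : lift T = S'.
      apply/setP => i; have [iS|/enumP[j ->]] := boolP (i \in S).
        by rewrite inE iS (fintype.subsetP (iffLR (exposed_sub S vS') SS')).
      by rewrite mem_lift inE.
    have qT : exposed q T by apply/exposed_lift; rewrite TS'.
    exists (chull q T); first by apply/(face_enum qL); exists T.
    by rewrite idxE // TS'.
- have dE : (2 * m - 2 * k)./2 = (m - k)%N by rewrite -mulnBr mul2n doubleK.
  apply: (exposed_neighbourly qL dL).
    by rewrite dE card_ord; move: cS; rewrite Sk; lia.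
  move=> T; rewrite dE => Tk; apply/exposed_lift; apply: univ.
    by rewrite card_imset //; exact: enum_val_inj.
  by apply/fintype.subsetP => _ /imsetP[j _ ->]; rewrite inE enumS.
- rewrite (nvertices_enum qL) (nvertices_enum vQ) card_ord.
  by move: cS; rewrite Sk; lia.
Qed.

End Quotient.

(** * Adding a point beyond some facets *)

Section UniversalP.
Context {R : realType} {m : nat} {I : finType}.
Variables (v : I -> 'rV[R]_(2 * m)) (Q : set 'rV[R]_(2 * m)).
Hypotheses (vQ : vertex_enum v Q) (sv : simplicial v).

(** The face is the hull of some exposed [S']. Each point indexed by [S'] is a vertex of [Q] lying
    in the hull of [S], hence one of the generators. *)
Lemma face_chull_exposed (S : {set I}) : face Q (chull v S) -> exposed v S.
Proof.
have [vI QE vV] := vQ; move=> QS;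
  have [S' vS' SE] := (iffLR (face_enum vQ _) QS).
suff -> : S = S' by [].
apply/eqP; rewrite finset.eqEsubset; apply/andP; split.
  by apply/(exposed_sub S vS'); rewrite SE.
apply/fintype.subsetP => i iS';
  suff [j jS /vI -> //] : exists2 j, j \in S & v i = v j.
apply: face_chull1; apply: (face_face (vV i)).
  by move=> _ ->; rewrite SE; exact: mem_chull.
by rewrite QE; apply: chullS; exact: finset.subsetT.
Qed.

Lemma card_enum : (2 * m < #|I|)%N.
Proof. by rewrite -cardsT ltnNge; apply/negP => /(exposed_neqT sv);
  rewrite eqxx. Qed.

Lemma universal_set_exposed (S : {set I}) k : (k <= m)%N -> #|S| = (2 * k)%N ->
  universal_set v S (m - k) -> exposed v S.
Proof.
move=> km Sk us; have cI := card_enum; have cS := cardsC S.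
have [||T [_ TS Tk]] := @set_between I finset.set0 (~: S) (m - k)%N.
- exact: finset.sub0set.
- by rewrite cards0; lia.
apply: (exposed_subset sv (us T Tk TS)); last exact: finset.subsetUl.
by apply: (exposed_neqT sv); rewrite cardsU Sk Tk; lia.
Qed.

(** For [k = m] the face is a facet and the only test set is empty; for smaller [k] the quotient
    decides. *)
Lemma universalP (S : {set I}) k : (0 < k <= m)%N -> #|S| = (2 * k)%N ->
  universal (2 * k - 1) Q (chull v S) <-> universal_set v S (m - k).
Proof.
move=> /andP[k0 km] Sk; split=> [US|us].
  have [/face_chull_exposed vS _ _] := US.
  by apply: (universal_universal_set vQ) => //; rewrite k0.
have vS := universal_set_exposed km Sk us.
have [kE|km'] := eqVneq k m; last first.
  by apply: (universal_set_universal vQ) => //; rewrite ltn_neqAle km'.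
have dS : affdim (chull v S) = (2 * k - 1)%N%:Z.
  rewrite affdim_chull ?Sk; first by lia.
  by have [_ iv] := sv; apply: iv => //; apply: (exposed_neqT sv); rewrite Sk;
    lia.
have fS : face Q (chull v S) by apply/(face_enum vQ); exists S.
split => //; left; split => //.
by rewrite dS (affdim_enum vQ sv) kE; lia.
Qed.

Lemma universal_enum U k : (0 < k <= m)%N -> universal (2 * k - 1) Q U ->
  exists S : {set I}, [/\ U = chull v S, #|S| = (2 * k)%N, exposed v S
                        & universal_set v S (m - k)].
Proof.
move=> k0m US; have [/(face_enum vQ)[S vS UE] dU _] := US.
have Sk : #|S| = (2 * k)%N.
  have ST : S != finset.setT.
    apply/eqP => ST; have [_ QE _] := vQ; move: dU; rewrite UE ST -QE.
    by rewrite (affdim_enum vQ sv); lia.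
  have [_ iv] := sv; move: dU; rewrite UE (affdim_chull (iv S vS ST)).
  by lia.
by exists S; split => //; apply/universalP => //; rewrite -UE.
Qed.

End UniversalP.

(** * Beyond and beneath as signs of the facet functional *)

Section Beyond.
Context {R : realType} {n : nat} {I : finType}.
Variables (v : I -> 'rV[R]_n) (P : set 'rV[R]_n).
Hypotheses (vP : vertex_enum v P) (sv : simplicial v).
Variables (f : 'rV[R]_n -> R) (A : {set I}).
Hypotheses (vf : supports v f A) (An : #|A| = n).

Lemma facet_apex : exists2 i, i \notin A & indep v (i |: A).
Proof.
have [fv iv] := sv; have vA : exposed v A by exists f.
have AT := facet_neqT fv vA An.
have [i iA] : exists i, i \notin A.
  apply/existsP; rewrite -negb_forall; apply: contra AT => /forallP AI.
  by apply/eqP/setP => i; rewrite AI inE.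
exists i => //; have [af _ fA] := vf.
by apply: (indepU1 (iv A vA AT) af (fun j => supports_eq0 vf (i := j)));
  rewrite fA.
Qed.

Lemma facet_chull : facet P (chull v A).
Proof.
have [fv iv] := sv; have vA : exposed v A by exists f.
have AT := facet_neqT fv vA An; have [_ PE _] := vP.
split; first by apply/(face_enum vP); exists A.
by rewrite (affdim_chull (iv A vA AT)) PE fv An.
Qed.

(** A zero of [f], expanded in the basis formed by [A] and an apex, has coefficient 0 at the
    apex. *)
Lemma affhull_facet : affhull (chull v A) = [set z | f z = 0].
Proof.
have [af f0 fA] := vf; apply/seteqP; split => z /=.
  move=> [r [p [c [pA c1 ->]]]]; rewrite affine_comb1 // big1 // => l _.
  by have := pA l; rewrite (chull_supports vf) => -[_ /= ->]; rewrite mulr0.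
have [i iA iI] := facet_apex;
  have iAn : #|i |: A| = n.+1 by rewrite cardsU1 iA An.
have [c [cS c1 ->]] := indep_span z iI iAn.
rewrite affine_comb1 // (bigD1 i) //= big1 ?addr0 => [|j ji]; last first.
  have [jA|jA] := boolP (j \in A); first by rewrite (supports_eq0 vf jA) mulr0.
  by rewrite cS ?mul0r // !inE negb_or ji.
move/eqP; rewrite mulf_eq0 fA (negbTE iA) orbF => /eqP ci.
have cA : supported A c.
  move=> j jA; have [->//|ji] := eqVneq j i.
  by apply: cS; rewrite !inE negb_or ji.
exists #|A|, (fun l => v (enum_val l)), (fun l => c (enum_val l)); split.
- by move=> l; apply: mem_chull; exact: enum_valP.
- by rewrite -sum_supported1.
- by rewrite -sum_supported.
Qed.

(** The separating functional is a priori unrelated to [f] except for its zero set, so the sign of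
    [f z] has to be compared with it through an apex. *)
Lemma beyond_gt0 z : beyond P (chull v A) z -> 0 < f z.
Proof.
rewrite /beyond affhull_facet => -[/eqP fz [u [c [u0 HE uP uz]]]].
rewrite ltNge; apply/negP => fz0;
  have {fz0} fz : f z < 0 by rewrite lt_neqAle fz.
have [i iA _] := facet_apex; have fi := supports_lt0 vf iA.
pose g y := dot u y - c; have ag : affine g by exists u, c.
have fg y : f y = 0 <-> g y = 0.
  have /seteqP[fu uf] := HE; split=> [/fu|/subr0_eq/uf //] /=.
  by rewrite /g => ->; rewrite subrr.
have gi : g (v i) < 0.
  rewrite lt_neqAle subr_le0 uP ?andbT; last first.
    by have [_ -> _] := vP; apply: mem_chull; rewrite inE.
  by apply/eqP => /fg fi0; rewrite fi0 ltxx in fi.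
have gz : 0 <= g z by rewrite subr_ge0.
(* The segment from z to v i meets the hyperplane, on which f cannot vanish. *)
have d0 : 0 < g z - g (v i) by rewrite subr_gt0 (lt_le_trans gi).
pose t := - g (v i) / (g z - g (v i)).
have t0 : 0 <= t by rewrite divr_ge0 ?oppr_ge0 ?(ltW gi) ?(ltW d0).
have t1 : t <= 1 by rewrite ler_pdivrMr // mul1r lerDr.
have : g (t *: z + (1 - t) *: v i) = 0.
  by rewrite affine_seg // /t; field; rewrite gt_eqF.
have [af _ _] := vf; move/fg; rewrite affine_seg //.
suff : t * f z + (1 - t) * f (v i) < 0 by move=> + E; rewrite E ltxx.
have [->|tN] := eqVneq t 0; first by rewrite mul0r add0r subr0 mul1r.
rewrite -(addr0 0) ltr_leD // ?pmulr_rlt0 // ?lt_neqAle ?(eq_sym 0) ?tN //.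
by rewrite mulr_ge0_le0 ?subr_ge0 ?(ltW fi).
Qed.

Lemma beneath_lt0 z : beneath P (chull v A) z -> f z < 0.
Proof.
rewrite /beneath affhull_facet => -[/eqP fz zP].
rewrite lt_neqAle fz leNgt; apply/negP => fz0; apply: zP.
have [[u [c fE]] _ fA] := vf; exists u, c; split.
(* With [u = 0] the functional [f] would be constant, yet it is negative at the apex and positive at
   [z]. *)
- apply/eqP => u0; have [i iA _] := facet_apex.
  have := supports_lt0 vf iA; rewrite fE u0 dot0l.
  by have := fz0; rewrite fE u0 dot0l; lra.
- by apply/seteqP; split => y /=; rewrite fE; [move/subr0_eq|move=> ->;
  rewrite subrr].
- by have [_ PE _] := vP; move=> y; rewrite PE => /(supports_le0 vf);
  rewrite fE subr_le0.
- by move: (ltW fz0); rewrite fE subr_ge0.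
Qed.

End Beyond.

(** * The faces of the polytope after adding a point *)

Section Sewn.
Context {R : realType} {n : nat} {I : finType}.
Variables (v : I -> 'rV[R]_n) (xbar : 'rV[R]_n) (bey : pred {set I}).
Hypothesis sv : simplicial v.
Hypothesis beyP : forall f A, supports v f A -> #|A| = n ->
  if bey A then 0 < f xbar else f xbar < 0.

Definition sewn_enum (o : option I) : 'rV[R]_n :=
  if o is Some i then v i else xbar.

Let w := sewn_enum.

Definition beneath_facet (S A : {set I}) : Prop :=
  [/\ exposed v A, #|A| = n, S \subset A & ~~ bey A].

Definition beyond_facet (S A : {set I}) : Prop :=
  [/\ exposed v A, #|A| = n, S \subset A & bey A].

Let trace (X : {set option I}) : {set I} := [set i | Some i \in X]%SET.

Implicit Types (X : {set option I}) (f : 'rV[R]_n -> R).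

Lemma supports_trace f X : supports w f X -> supports v f (trace X).
Proof.
move=> [af f0 fS]; split => // i; first exact: (f0 (Some i)).
by rewrite inE -fS.
Qed.

Lemma trace_neqT f X : supports w f X -> X != finset.setT -> trace X !=
  finset.setT.
Proof.
move=> wf; apply: contra => /eqP ST; have [fv _] := sv; have [af _ fS] := wf.
have f0 : forall z, f z = 0.
  apply: (full_affine0 fv af) => i.
  by apply: (supports_eq0 (supports_trace wf)); rewrite ST inE.
by apply/eqP/setP => o; rewrite -fS f0 eqxx inE.
Qed.

(** If all facets above the trace were beyond, the facet cone would make every supporting functional
    positive at [xbar]. Conversely, a large multiple of a beneath facet functional, added to one
    exposing the trace, is negative at [xbar]. *)
Lemma exposed_sewn_Some X : None \notin X ->
  exposed w X <-> exists A, beneath_facet (trace X) A.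
Proof.
move=> NS; split=> [[f wf]|[A [vA An SA nA]]].
  apply: contrapT => /forallNP H.
  have ST : X != finset.setT by apply: contraNneq NS => ->; rewrite inE.
  suff : 0 < f xbar by rewrite ltNge ltW // (supports_lt0 wf NS).
  apply: (facet_cone sv (N := fun f => 0 < f xbar) (supports_trace wf)).
  - exact: trace_neqT wf ST.
  - move=> h A vh An SA; have := beyP vh An; case: ifP => // /negbT nA _.
    by case: (H A); split => //; exists h.
  - by move=> f1 f2 a b a0 b0 f10 f20; rewrite addr_gt0 // mulr_gt0.
have [g vg] := exposed_subset_facet sv vA An SA; have [f vf] := vA.
have := beyP vf An; rewrite (negbTE nA) => fx.
have [af f0 fA] := vf; have [ag g0 gS] := vg.
have [N N0 Nlt] := perturbation (f \o w) (g \o w).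
exists (fun z => N * f z + g z); split.
- by apply: affineD => //; exact: affineZ.
- case=> [i|] /=; last exact: ltW (Nlt None fx).
  by rewrite -(addr0 0) lerD // mulr_ge0_le0 // ltW.
- case=> [i|] /=; last by rewrite (negbTE NS) lt_eqF //; exact: (Nlt None fx).
  have -> : (Some i \in X) = (i \in trace X) by rewrite inE.
  have [iS|iS] := boolP (i \in trace X).
    rewrite (supports_eq0 vg iS) (supports_eq0 vf (fintype.subsetP SA i iS)).
    by rewrite mulr0 addr0 eqxx.
  rewrite lt_eqF // -(addr0 0) ler_ltD ?(supports_lt0 vg) //.
  by rewrite mulr_ge0_le0 // ltW.
Qed.

(** A functional vanishing at [xbar] cannot come from facet functionals of one sign there.
    Conversely, a functional exposing the trace is corrected by a nonnegative multiple of a facet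
    functional of opposite sign at [xbar], so that the sum vanishes there. *)
Lemma exposed_sewn_None X : None \in X -> X != finset.setT ->
  exposed w X <->
  (exists A, beneath_facet (trace X) A) /\ (exists A, beyond_facet (trace X) A).
Proof.
move=> NS ST; split=> [[f wf]|[[A1 [vA1 A1n SA1 nA1]] [A2 [vA2 A2n SA2 bA2]]]].
  have fx : f xbar = 0 := supports_eq0 wf NS.
  have cone N := @facet_cone _ _ _ v N f _ sv (supports_trace wf) (trace_neqT
    wf ST).
  split; apply: contrapT => /forallNP H.
    suff : 0 < f xbar by rewrite fx ltxx.
    apply: (cone (fun f => 0 < f xbar)) => [h A vh An SA|].
      have := beyP vh An; case: ifP => // /negbT nA _.
      by case: (H A); split => //; exists h.
    by move=> f1 f2 a b a0 b0 f10 f20; rewrite addr_gt0 // mulr_gt0.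
  suff : f xbar < 0 by rewrite fx ltxx.
  apply: (cone (fun f => f xbar < 0)) => [h A vh An SA|].
    have := beyP vh An; case: ifP => // nA _.
    by case: (H A); split => //; exists h.
  move=> f1 f2 a b a0 b0 f10 f20.
  by rewrite -(addr0 0) ltrD // pmulr_rlt0.
have [g vg] := exposed_subset_facet sv vA1 A1n SA1; have [ag g0 gS] := vg.
have [f [A [vf SA fx fg]]] : exists f A, [/\ supports v f A, trace X \subset A,
    f xbar != 0 & 0 <= - (g xbar / f xbar)].
  have [g0x|g0x] := leP 0 (g xbar).
    have [f vf] := vA1; exists f, A1.
    have := beyP vf A1n; rewrite (negbTE nA1) => fx; split => //.
      by rewrite lt_eqF.
    by rewrite -mulrN mulr_ge0 // oppr_ge0 invr_le0 ltW.
  have [f vf] := vA2; exists f, A2.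
  have := beyP vf A2n; rewrite bA2 => fx; split => //; first by rewrite gt_eqF.
  by rewrite -mulNr; apply: mulr_ge0; rewrite ?invr_ge0 ?oppr_ge0 ltW.
have [af f0 fA] := vf.
exists (fun z => - (g xbar / f xbar) * f z + g z); split.
- by apply: affineD => //; exact: affineZ.
- case=> [i|] /=; last by rewrite mulNr mulfVK // addNr.
  by rewrite -(addr0 0) lerD // mulr_ge0_le0.
- case=> [i|] /=; last by rewrite NS mulNr mulfVK // addNr eqxx.
  have -> : (Some i \in X) = (i \in trace X) by rewrite inE.
  have [iS|iS] := boolP (i \in trace X).
    rewrite (supports_eq0 vg iS) (supports_eq0 vf (fintype.subsetP SA i iS)).
    by rewrite mulr0 addr0 eqxx.
  rewrite lt_eqF // -(addr0 0) ler_ltD ?(supports_lt0 vg) //.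
  by rewrite mulr_ge0_le0.
Qed.

(** The trace of a proper face lies in an old facet, whose vertices are independent. If the face
    contains [xbar], that facet can be taken beneath, and its functional, nonzero at [xbar], kills
    the coefficient of [xbar]. *)
Lemma sewn_simplicial : simplicial w.
Proof.
have [fv iv] := sv; split.
  apply/le_anti/andP; split; first exact: affdim_max.
  rewrite -{1}fv; apply: affdim_le; apply: hullS => _ [i _ <-].
  by exists (Some i); rewrite //= inE.
move=> X wS ST c cS c0 cw.
have part A : exposed v A -> #|A| = n -> trace X \subset A -> c None = 0 ->
    forall o, c o = 0.
  move=> vA An SA cN; have iA := iv A vA (facet_neqT fv vA An).
  have cI : forall i, c (Some i) = 0.
    apply: (iA (c \o Some)).
    - by move=> i iA'; apply: cS; apply: contra iA' => iS;
        apply: (fintype.subsetP SA); rewrite inE.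
    - by move: c0; rewrite sum_option cN add0r.
    - by move: cw; rewrite sum_option cN scale0r add0r.
  by case.
have [NS|NS] := boolP (None \in X); last first.
  have [A [vA An SA _]] := iffLR (exposed_sewn_Some NS) wS.
  by apply: (part A) => //; exact: cS.
have [[A [vA An SA nA]] _] := iffLR (exposed_sewn_None NS ST) wS.
apply: (part A) => //; have [f vf] := vA.
have := beyP vf An; rewrite (negbTE nA) => fx; have [af _ _] := vf.
have /eqP := affine_comb0 af c0 cw; rewrite sum_option big1 => [|i _].
  by rewrite addr0 mulf_eq0 (lt_eqF fx) orbF => /eqP.
have [iS|iS] := boolP (i \in trace X).
  by rewrite (supports_eq0 vf (fintype.subsetP SA i iS)) mulr0.
by rewrite cS ?mul0r //; move: iS; rewrite inE.
Qed.

(** An old vertex survives if it lies in a beneath facet; the new point has empty trace, so one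
    facet of each kind suffices for it. *)
Lemma sewn_vertex_enum P : vertex_enum v P ->
  (forall i, exists A, beneath_facet [set i]%SET A) ->
  (exists A, beneath_facet finset.set0 A) -> (exists A,
    beyond_facet finset.set0 A) ->
  vertex_enum w (hull (P `|` [set xbar])).
Proof.
move=> [vI PE _] bi b0 b1.
have wE : hull (P `|` [set xbar]) = chull w finset.setT.
  rewrite PE hull_hullU; congr hull; apply/seteqP; split => z.
    by move=> [[i _ <-]|->]; [exists (Some i)|exists None]; rewrite //= inE.
  by move=> [[i|] _ <-]; [left; exists i; rewrite //= inE|right].
have w1 o : exposed w [set o]%SET.
  case: o => [i|].
    apply/exposed_sewn_Some; first by rewrite inE.
    by have [A [vA An iA nA]] := bi i; exists A; split => //;
      rewrite (_ : trace _ = [set i]%SET) //; apply/setP => j; rewrite !inE.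
  have tr : trace [set None]%SET = finset.set0 by apply/setP => j; rewrite !inE.
  apply/exposed_sewn_None; rewrite ?tr ?inE //.
  have [A [vA An _ _]] := b0; have AT := facet_neqT sv.1 vA An.
  apply/eqP => NT; move/eqP: AT; apply; apply/setP => j.
  by have /setP/(_ (Some j)) := NT; rewrite !inE.
split => // [o o' eqw|o].
  have := exposed_mem o' (w1 o); rewrite -eqw inE => -[H _].
  by apply/esym/eqP/H; apply: mem_chull; rewrite inE.
rewrite /vertices /= wE -chull1; exact: exposed_face.
Qed.

End Sewn.

(** * Sewing *)

(** The Radon argument with [K] empty and [d = m]. *)
Lemma neighbourly_general_position (R : realType) (m : nat) (I : finType)
    (v : I -> 'rV[R]_(2 * m)) (P : set 'rV[R]_(2 * m)) :
  vertex_enum v P -> neighbourly (2 * m) P -> (m < #|I|)%N -> general_position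
    v.
Proof.
move=> vP nP mI S Sn c cS c0 cv i.
apply: (@radon _ _ _ v finset.set0 S m c) => //; rewrite ?inE //.
- move=> T Tm _; rewrite finset.set0U; apply: (neighbourly_exposed vP nP).
  by rewrite Tm mul2n doubleK.
- by rewrite finset.setC0 cardsT.
- by rewrite finset.set0U.
- by rewrite -mul2n.
Qed.

Section Tower.
Context {R : realType} {n : nat}.
Variables (m : nat) (x y : nat -> 'rV[R]_n) (P : set 'rV[R]_n).

Lemma PhiS j : Phi x y j `<=` Phi x y j.+1.
Proof. by move=> z Pz; apply: sub_hull; left. Qed.

Lemma Phi_le i j : (i <= j)%N -> Phi x y i `<=` Phi x y j.
Proof.
elim: j => [|j IH]; first by rewrite leqn0 => /eqP ->.
rewrite leq_eqVlt => /orP[/eqP -> //|/IH ij].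
by move=> z /ij /PhiS.
Qed.

Lemma Phi_x j : Phi x y j.+1 (x j.+1).
Proof. by apply: sub_hull; right; left. Qed.

Lemma Phi_y j : Phi x y j.+1 (y j.+1).
Proof. by apply: sub_hull; right; right. Qed.

(** As the tower is increasing, [i] is the only index for which [F] belongs to its tower class but
    not to the next one. *)
Lemma tower_C_odd F i : facet P F -> (i < m)%N ->
  Phi x y i `<=` F -> ~ (Phi x y i.+1 `<=` F) -> tower_C m x y P F <-> odd i.
Proof.
move=> PF im iF iF1; split=> [[j /= oj [[jm _ jF] jF1]]|oi].
  have [ij|ji|-> //] := ltngtP i j.
    by case: iF1 => z /(Phi_le ij) /jF.
  case: jF1; split => //; first exact: leq_trans ji (ltnW im).
  by move=> z /(Phi_le ji) /iF.
by exists i => //; split; [split => //; exact: ltnW|case].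
Qed.

End Tower.

Theorem theorem5p4 (R : realType) (m : nat) (m_gt1 : (1 < m)%N)
    (P : set 'rV[R]_(2 * m))
    (P_neighbourly : neighbourly (2 * m)%N P)
    (P_vertices : (2 * m + 3 <= nvertices P)%N)
    (x y : nat -> 'rV[R]_(2 * m))
    (tower : universal_tower m x y P)
    (xbar : 'rV[R]_(2 * m)) (Pplus : set 'rV[R]_(2 * m))
    (Pplus_sewn : sewn m x y P xbar Pplus)
    (i k : nat) (lt_ik : (i < k)%N) (lt_km : (k < m)%N)
    (U : set 'rV[R]_(2 * m))
    (U_universal : universal (2 * k - 1)%N P U)
    (Phi_sub_U : Phi x y i `<=` U)
    (x_notin_U : ~ U (x i.+1)) :
  universal (2 * k - 1)%N Pplus U <->
  ~~ odd i /\
  universal (2 * k + 1)%N Pplus (hull (U `|` [set xbar; x i.+1])).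
Proof.
have [polP dimP _] := P_neighbourly.
have [N [v vP]] := polytope_vertex_enum polP.
have cI : (2 * m + 3 <= N)%N by rewrite -(card_ord N) -(nvertices_enum vP).
have [vI PE vV] := vP.
have gp : general_position v.
  by apply: (neighbourly_general_position vP P_neighbourly); rewrite card_ord;
    lia.
have fv : full v by rewrite /full -PE.
have sv : simplicial v := general_position_simplicial fv gp.
have [xy_uniq xyV _] := tower.
have Vindex z : vertices P z -> exists a, z = v a.
  by rewrite PE => /face_chull1[a _ ->]; exists a.
have facetP A : exposed v A -> #|A| = (2 * m)%N -> facet P (chull v A).
  by move=> [f vf] An; exact: (facet_chull vP sv vf An).
have small (S : {set 'I_N}) : (#|S| <= m)%N -> exposed v S.
  move=> Sm; have [||T [ST _ Tm]] := @set_between _ S finset.setT m.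
  - exact: finset.subsetT.
  - by rewrite Sm cardsT card_ord; lia.
  apply: (exposed_subset sv _ _ ST).
    by apply: (neighbourly_exposed vP P_neighbourly); rewrite Tm mul2n doubleK.
  by apply: (exposed_neqT sv); rewrite Tm; lia.
pose bey (A : {set 'I_N}) := `[< tower_C m x y P (chull v A) >].
have [exact_beyond PplusE] := Pplus_sewn.
have beyP f A : supports v f A -> #|A| = (2 * m)%N ->
    if bey A then 0 < f xbar else f xbar < 0.
  move=> vf An; have [beyA benA] := exact_beyond _ (facet_chull vP sv vf An).
  rewrite /bey; case: asboolP => CA.
    exact: (beyond_gt0 vP sv vf An (beyA CA)).
  exact: (beneath_lt0 vP sv vf An (benA CA)).
have bey_odd A j : exposed v A -> #|A| = (2 * m)%N -> (j < m)%N ->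
    Phi x y j `<=` chull v A -> ~ (Phi x y j.+1 `<=` chull v A) -> bey A = odd
      j.
  move=> vA An jm jA jA1; apply/asboolP/idP => [/tower_C_odd|oj].
    by move=> /(_ _ (facetP A vA An) jm jA jA1).
  exact/(tower_C_odd (facetP A vA An) jm jA jA1).
have Phi0 A : Phi x y 0 `<=` chull v A by [].
have [x1V y1V] := xyV 1%N ltac:(lia); have [x2V _] := xyV 2%N ltac:(lia).
have xy_neq : [/\ x 1%N <> y 1%N, x 1%N <> x 2%N & y 1%N <> x 2%N].
  move: xy_uniq; rewrite cat_uniq => /and3P[ux /hasPn xy _].
  have inx j : (1 <= j <= m)%N -> x j \in [seq x j | j <- iota 1 m].
    by move=> jm; apply: map_f; rewrite mem_iota; lia.
  have y1in : y 1%N \in [seq y j | j <- iota 1 m].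
    by apply: map_f; rewrite mem_iota; lia.
  split.
  - by move=> xyE; have := xy _ y1in; rewrite /= -xyE inx //; lia.
  - move=> xxE; have := uniqP 0 ux 0%N 1%N; rewrite !inE size_map size_iota.
    rewrite !(nth_map 0%N) ?size_iota ?nth_iota ?add1n //; try lia.
    by move=> /(_ ltac:(lia) ltac:(lia) xxE).
  - by move=> yxE; have := xy _ y1in; rewrite /= yxE inx //; lia.
have [x1y1 x1x2 y1x2] := xy_neq.
have [[a1 x1E] [b1 y1E] [a2 x2E]] :=
  And3 (Vindex _ x1V) (Vindex _ y1V) (Vindex _ x2V).
have Vfacet (S : {set 'I_N}) b : exposed v S -> b \notin S -> exists A,
    [/\ exposed v A, #|A| = (2 * m)%N, S \subset A & ~ chull v A (v b)].
  move=> vS bS; have [A [vA An SA bA]] := facet_avoiding sv vS bS.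
  by exists A; split => //; move/(exposed_mem b vA); apply/negP.
(* One of [x 1], [y 1] differs from [v a]; a facet through [a] avoiding it does not contain [Phi 1],
   so it is beneath. *)
have beneath1 a : exists A, beneath_facet v bey [set a]%SET A.
  have va : exposed v [set a]%SET by apply: small; rewrite cards1; lia.
  have [b ab Phib] : exists2 b, b != a & Phi x y 1 (v b).
    have [a1a|] := eqVneq a1 a; last by exists a1; rewrite // -x1E;
      exact: Phi_x.
    exists b1; last by rewrite -y1E; exact: Phi_y.
    by apply/eqP => b1a; apply: x1y1; rewrite x1E y1E a1a b1a.
  have [|A [vA An aA bA]] := Vfacet [set a]%SET b va; first by rewrite inE.
  exists A; split => //; rewrite (bey_odd A 0%N) //; first by lia.
  by move=> /(_ _ Phib).
have beneath0 : exists A, beneath_facet v bey finset.set0 A.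
  have [A [vA An _ nA]] := beneath1 a1.
  by exists A; split => //; exact: finset.sub0set.
(* A facet through [x 1] and [y 1] avoiding [x 2] contains [Phi 1] but not [Phi 2]; both its
   existence and that of [x 2] in the tower rest on [m_gt1]. *)
have beyond0 : exists A, beyond_facet v bey finset.set0 A.
  pose S : {set 'I_N} := [set a1; b1]%SET.
  have vS : exposed v S by apply: small; rewrite cards2; case: (_ != _); lia.
  have a2S : a2 \notin S.
    rewrite !inE negb_or; apply/andP.
    by split; apply/eqP => E; [apply: x1x2|apply: y1x2]; rewrite x2E E.
  have [A [vA An SA a2A]] := Vfacet S a2 vS a2S.
  exists A; split => //; first exact: finset.sub0set.
  rewrite (bey_odd A 1%N) //.
    rewrite /=; apply: hull_subset; first exact: convex_hull.
    move=> z [//|[->|->]]; [rewrite x1E|rewrite y1E]; apply: mem_chull;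
    by apply: (fintype.subsetP SA); rewrite !inE eqxx ?orbT.
  by move=> /(_ _ (@Phi_x _ _ x y 1)); rewrite x2E.
pose w := sewn_enum v xbar.
have sw : simplicial w := sewn_simplicial sv beyP.
have wP : vertex_enum w Pplus.
  by rewrite PplusE; exact: (sewn_vertex_enum sv beyP).
have [S [UE Sk vS usU]] : exists S : {set 'I_N}, [/\ U = chull v S,
    #|S| = (2 * k)%N, exposed v S & universal_set v S (m - k)].
  by apply: (universal_enum vP sv) => //; lia.
have [xiV _] := xyV i.+1 ltac:(lia); have [a xiE] := Vindex _ xiV.
have aS : a \notin S.
  by apply/negP => aS; apply: x_notin_U; rewrite UE xiE; exact: mem_chull.
have bey_i A : exposed v A -> #|A| = (2 * m)%N -> S \subset A -> a \notin A ->
    bey A = odd i.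
  move=> vA An SA aA; apply: bey_odd => //; first by lia.
    by move=> z /Phi_sub_U; rewrite UE; exact: (chullS SA).
  move=> /(_ _ (@Phi_x _ _ x y i)); rewrite xiE => /(exposed_mem a vA).
  by apply/negP.
pose S1 : {set option 'I_N} := [set Some b | b in S]%SET.
pose W1 : {set option 'I_N} := None |: (Some a |: S1).
have memS1 b : (Some b \in S1) = (b \in S).
  by apply/imsetP/idP => [[c cS [->]]|bS] //; exists b.
have NS1 : None \notin S1 by apply/imsetP => -[].
have S1k : #|S1| = (2 * k)%N by rewrite card_imset // => b c [].
have W1k : #|W1| = (2 * k.+1)%N.
  by rewrite cardsU1 !inE /= (negbTE NS1) cardsU1 memS1 (negbTE aS) S1k; lia.
have US1 : U = chull w S1.
  rewrite UE; congr hull; apply/seteqP; split => z [].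
    by move=> b bS <-; exists (Some b); rewrite //= memS1.
  by move=> [b|] /=; rewrite ?memS1 ?(negbTE NS1) // => bS <-; exists b.
have W1E : hull (U `|` [set xbar; x i.+1]) = chull w W1.
  rewrite US1 hull_hullU; congr hull; apply/seteqP; split => z.
    move=> [[o oS <-]|[->|->]].
    - by exists o; rewrite // /W1 /= !inE oS !orbT.
    - by exists None; rewrite // /W1 /= !inE.
    - by exists (Some a); rewrite // /W1 /= !inE eqxx ?orbT.
  move=> [o]; rewrite /W1 /= !inE => /or3P[/eqP ->|/eqP ->|oS] <-.
  - by right; left.
  - by right; right; rewrite xiE.
  - by left; exists o.
(* In this form the criterion [universalP] applies to [W1] with [k.+1]. *)
have -> : (2 * k + 1)%N = (2 * k.+1 - 1)%N by lia.
rewrite W1E US1 (universalP wP sw _ S1k) ?(universalP wP sw _ W1k); try lia.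
have wT (X : {set option 'I_N}) : (#|X| <= 2 * m)%N -> X != finset.setT.
  exact: (exposed_neqT sw).
have beneathP (X : {set option 'I_N}) : None \notin X ->
    exposed w X <-> exists A, beneath_facet v bey [set b | Some b \in X]%SET A.
  exact: (exposed_sewn_Some sv beyP).
have beyondP (X : {set option 'I_N}) : None \in X -> (#|X| <= 2 * m)%N ->
  exposed w X <->
    (exists A, beneath_facet v bey [set b | Some b \in X]%SET A) /\
    (exists A, beyond_facet v bey [set b | Some b \in X]%SET A).
  by move=> NX Xm; apply: (exposed_sewn_None sv beyP) => //; exact: wT.
have SomeT (T : {set 'I_N}) : [/\ None \notin [set Some b | b in T]%SET,
    #|[set Some b | b in T]%SET| = #|T| &
    forall b, (Some b \in [set Some b | b in T]%SET) = (b \in T)].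
  split; first by apply/imsetP => -[].
    by rewrite card_imset // => b c [].
  by move=> b; apply/imsetP/idP => [[c cS [->]]|bS] //; exists b.
split=> [us1|[even_i usW]]; last first.
  move=> T Tk TS.
  (* If [T] meets the two new indices of [W1], the rest of [T] has at most [m - k.+1] elements and
     can be completed to a test set for [W1]. *)
  have [NaT|NaT] := boolP ((None \in T) || (Some a \in T)).
    pose T0 := T :\ None :\ Some a.
    have T0k : (#|T0| <= m - k.+1)%N.
      have Tab := cardsD1 (Some a) (T :\ None); have TN := cardsD1 None T.
      move: NaT Tab TN; rewrite -/T0 Tk !inE /=.
      by case: (None \in T); case: (Some a \in T) => //= _; lia.
    have [||T1 [T01 T1W T1k]] := @set_between _ T0 (~: W1) (m - k.+1)%N.
    - apply/fintype.subsetP => o; rewrite !inE !negb_or => /and3P[-> -> oT] /=.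
      by have := fintype.subsetP TS o oT; rewrite inE.
    - by rewrite T0k /= -(leq_add2l #|W1|) cardsC card_option card_ord W1k; lia.
    apply: (exposed_subset sw (usW T1 T1k T1W)).
      by apply: wT; rewrite cardsU W1k T1k; lia.
    apply/fintype.subsetP => o; rewrite !inE => /orP[->|oT];
      first by rewrite !orbT.
    have [->//|oN] := eqVneq o None; have [->//|oa] := eqVneq o (Some a).
    by rewrite (fintype.subsetP T01) ?orbT // !inE oN oa.
  move: NaT; rewrite negb_or => /andP[NT aT].
  pose T0 := [set b | Some b \in T]%SET.
  have TE : T = [set Some b | b in T0]%SET.
    apply/setP => -[b|]; have [NT0 _ memT0] := SomeT T0.
      by rewrite memT0 inE.
    by rewrite (negbTE NT) (negbTE NT0).
  apply/beneathP; first by rewrite inE negb_or NS1.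
  have T0k : #|T0| = (m - k)%N by have [_ <- _] := SomeT T0; rewrite -TE.
  have T0S : T0 \subset ~: S.
    apply/fintype.subsetP => b; rewrite !inE => bT.
    by have := fintype.subsetP TS _ bT; rewrite inE memS1.
  have aST0 : a \notin S :|: T0 by rewrite !inE negb_or aS.
  (* A facet avoiding [a] is beneath because [i] is even. *)
  have [A [vA An STA aA]] := facet_avoiding sv (usU T0 T0k T0S) aST0.
  exists A; split => //.
    rewrite (_ : [set _ | _]%SET = S :|: T0) //.
    by apply/setP => b; rewrite !inE memS1.
  rewrite (bey_i A) //; exact: fintype.subset_trans (finset.subsetUl _ _) STA.
have beneathT (T : {set 'I_N}) : #|T| = (m - k)%N -> T \subset ~: S ->
    exists A, beneath_facet v bey (S :|: T) A.
  move=> Tk TS; have [NT cT memT] := SomeT T.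
  have := us1 [set Some b | b in T]%SET; rewrite cT => /(_ Tk) [].
    apply/fintype.subsetP => -[b|]; rewrite ?(negbTE NT) // memT inE memS1.
    by move=> /(fintype.subsetP TS); rewrite inE.
  move=> f wf; have [|A HA] := iffLR (beneathP _ _) (ex_intro _ f wf).
    by rewrite inE negb_or NS1.
  exists A; rewrite (_ : S :|: T = [set b | Some b \in S1 :|: [set Some b | b
    in T]]%SET) //.
  by apply/setP => b; rewrite !inE memS1 memT.
have even_i : ~~ odd i.
  apply/negP => odd_i; pose K := a |: S.
  have Kk : #|K| = (2 * k).+1 by rewrite cardsU1 aS Sk.
  (* For odd [i] a beneath facet through [S] must contain [a], so [a] can be added to every face in
     question. *)
  have usK (T : {set 'I_N}) : #|T| = (m - k)%N -> T \subset ~: K -> exposed v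
    (K :|: T).
    move=> Tk TK; have [|A [vA An STA nA]] := beneathT T Tk.
      apply: fintype.subset_trans TK _.
      by rewrite finset.setCS finset.subsetU1.
    apply: (exposed_subset_facet sv vA An);
      rewrite -finset.setUA finset.subUset STA andbT.
    rewrite finset.sub1set; apply: contraNT nA => aA; rewrite (bey_i A) //.
    exact: fintype.subset_trans (finset.subsetUl _ _) STA.
  (* [K] and [D] together have [2 m + 2] elements, just enough to be dependent. By [radon] the
     dependence lives on [K], which is independent. *)
  have [||D [_ DK Dk]] := @set_between _ finset.set0 (~: K) (m - k).*2.+1.
  - exact: finset.sub0set.
  - by rewrite cards0 /= -(leq_add2l #|K|) cardsC card_ord Kk -mul2n; lia.
  have KD : #|K :|: D| = (2 * m).+2.
    have /eqP KD0 : K :&: D == finset.set0.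
      by rewrite -finset.subset0; apply/fintype.subsetP => b; rewrite inE =>
        /andP[bK /(fintype.subsetP DK)]; rewrite inE bK.
    by rewrite cardsU KD0 cards0 subn0 Kk Dk -mul2n; lia.
  have [|c [cKD c0 cv [b cb]]] := @affine_dependence _ _ _ v (K :|: D).
    by rewrite KD.
  have cK0 : supported K c.
    apply: (radon usK _ c0 cv cKD); last by rewrite Dk.
    by rewrite -(ltn_add2l #|K|) cardsC card_ord Kk; lia.
  have KS : indep v K by apply: gp; rewrite Kk; lia.
  by rewrite (KS c cK0 c0 cv) eqxx in cb.
split=> // T Tk TW.
have NW : None \in W1 by rewrite !inE.
apply/beyondP; first by rewrite inE NW.
  by rewrite cardsU W1k Tk; lia.
pose T0 := [set b | Some b \in T]%SET.
have NT : None \notin T by apply/negP => /(fintype.subsetP TW); rewrite inE NW.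
have TE : T = [set Some b | b in T0]%SET.
  apply/setP => -[b|]; have [NT0 _ memT0] := SomeT T0.
    by rewrite memT0 inE.
  by rewrite (negbTE NT) (negbTE NT0).
have T0k : #|T0| = (m - k.+1)%N by have [_ <- _] := SomeT T0; rewrite -TE.
have T0W b : b \in T0 -> b != a /\ b \notin S.
  rewrite inE => /(fintype.subsetP TW); rewrite !inE /= memS1 negb_or.
  by case/andP => [/eqP ba bS]; split => //; apply/eqP => E; apply: ba;
    rewrite E.
have aT0 : a \notin T0 by apply/negP => /T0W[]; rewrite eqxx.
have -> : [set b | Some b \in W1 :|: T]%SET = S :|: (a |: T0).
  apply/setP => b; rewrite !inE memS1 /=.
  by case: (b \in S); rewrite ?orbT ?orbF.
split.
  apply: beneathT; first by rewrite cardsU1 aT0 T0k; lia.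
  apply/fintype.subsetP => b; rewrite in_setU1 finset.in_setC.
  by move=> /orP[/eqP -> //|/T0W[_]].
(* Testing the universality of [S1] with [xbar] added to [T] yields a beyond facet through [S] and
   [T0]; as [i] is even, that facet also contains [a]. *)
pose T1 := None |: T.
have T1k : #|T1| = (m - k)%N by rewrite cardsU1 NT Tk; lia.
have T1S : T1 \subset ~: S1.
  apply/fintype.subsetP => o;
    rewrite in_setU1 finset.in_setC => /orP[/eqP -> //|].
  by move=> /(fintype.subsetP TW); rewrite !inE !negb_or => /and3P[].
have NX : None \in S1 :|: T1 by rewrite !inE eqxx orbT.
have Xm : (#|S1 :|: T1| <= 2 * m)%N by rewrite cardsU S1k T1k; lia.
have [_ [A [vA An SA bA]]] := iffLR (beyondP _ NX Xm) (us1 T1 T1k T1S).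
exists A; split => //.
have STA : S :|: T0 \subset A.
  apply: fintype.subset_trans SA; apply/fintype.subsetP => b.
  by rewrite !inE memS1.
have SA' : S \subset A := fintype.subset_trans (finset.subsetUl _ _) STA.
rewrite finset.setUCA finset.subUset STA andbT finset.sub1set.
by apply: contraTT bA => aA; rewrite (bey_i A).
Qed.
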